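(* Let $\psi$ be a smooth positive function on $(-1,1)$ with $\psi(t)=e^{-1/t^2}\sin\frac1t+1$ for $t\in(-\frac12,\frac12)$ (with $\psi(0)=1$), and let $h=\psi(t)(d\mathfrak{s}^2+dt^2)$, a Riemannian metric on $S^2\times(-1,1)$. Then $4\pi$ is not a discrete number in $\mathcal{E}(S^2\times(-1,1),h)$, i.e. $4\pi$ is a limit point of this set. In particular, there exists a Riemannian manifold $(N,h)$ for which $\mathcal{E}(N,h)$ is not discrete.
   Context: $d\mathfrak{s}^2$ is the standard round metric on the unit sphere $S^2$. For a Riemannian manifold $(N,h)$, $\mathcal{E}(N,h)=\{E(u): u \text{ is a harmonic map from } S^2 \text{ into } (N,h)\}$, where $S^2$ carries its standard metric and $E(u)=\frac12\int_{S^2}|\nabla u|^2\,dV$ is the energy. Harmonic maps are the critical points of $E$; constant maps are harmonic. *)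

(* Defs.v *)
From HB Require Import structures.
From mathcomp Require Import all_boot all_order all_algebra.
From mathcomp Require Import all_classical all_reals all_analysis.

Set Implicit Arguments.
Unset Strict Implicit.
Unset Printing Implicit Defensive.

Import Order.TTheory GRing.Theory Num.Theory.
Import numFieldNormedType.Exports.

Local Open Scope classical_set_scope.
Local Open Scope ring_scope.

(* f is C^k on the set U, which is meant to be open *)
Fixpoint Ck (R : realType) (V W : normedModType R) (k : nat) (U : set V)
    (f : V -> W) : Prop :=
  match k with
  | 0%N => forall x, U x -> {for x, continuous f}
  | k'.+1 => (forall x, U x -> differentiable f x) /\
             (forall v, Ck k' U ('D_v f))
  end.

(* Smoothness on an arbitrary subset A of a normed space: near each point of A,
   f is the restriction to A of a C^infinity map defined on an open set.
   Values of f outside A are irrelevant. *)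
Definition smooth_on (R : realType) (V W : normedModType R) (A : set V)
    (f : V -> W) : Prop :=
  forall x, A x -> exists (U : set V) (F : V -> W),
    [/\ open U, U x, forall k, Ck k U F &
        forall y, A y -> U y -> F y = f y].

(* Manifolds are embedded submanifolds of a Euclidean space 'rV[R]_n; by
   Whitney's theorem this is no restriction up to diffeomorphism. *)
Definition submanifold (R : realType) (m n : nat) (N : set 'rV[R]_n) : Prop :=
  forall p, N p ->
  exists (U : set 'rV[R]_n) (V : set 'rV[R]_m)
         (f : 'rV[R]_m -> 'rV[R]_n) (g : 'rV[R]_n -> 'rV[R]_m),
    [/\ open U /\ U p, open V, f @` V = N `&` U,
        smooth_on V f /\ smooth_on (N `&` U) g &
        forall y, V y -> g (f y) = y].

(* v is the velocity at time 0 of a smooth curve in N through p *)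
Definition tangent (R : realType) (n : nat) (N : set 'rV[R]_n)
    (p v : 'rV[R]_n) : Prop :=
  exists (e : R) (c : R^o -> 'rV[R]_n),
    [/\ 0 < e, smooth_on ([set s | - e < s < e] : set R^o) c,
        forall s, - e < s < e -> N (c s), c 0 = p & 'D_1 c 0 = v].

Definition bilin (R : realType) (n : nat) (B : 'M[R]_n) (v w : 'rV[R]_n) : R :=
  (v *m B *m w^T) 0 0.

(* The metric at p is the restriction of the form bilin (h p) to the tangent
   space of N at p; every metric arises in this way, by composing with the
   orthogonal projection onto the tangent space. *)
Definition riemannian_manifold (R : realType) (m n : nat) (N : set 'rV[R]_n)
    (h : 'rV[R]_n -> 'M[R]_n) : Prop :=
  [/\ submanifold m N, smooth_on N h, forall p, N p -> (h p)^T = h p &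
      forall p v, N p -> tangent N p v -> v != 0 -> 0 < bilin (h p) v v].

(* Explicit Euclidean norm: the library's norm on matrices is the sup norm. *)
Definition enorm (R : realType) (n : nat) (x : 'rV[R]_n) : R :=
  Num.sqrt (\sum_i x 0 i ^+ 2).

Definition S2 (R : realType) : set 'rV[R]_3 := [set x | enorm x = 1].

Definition S2_ext (R : realType) (n : nat) (u : 'rV[R]_3 -> 'rV[R]_n) :
    'rV[R]_3 -> 'rV[R]_n :=
  fun y => u ((enorm y)^-1 *: y).

(* |grad u|^2 = tr (u^* h) at the point x of S2: the differential at x of
   S2_ext u is that of u on the tangent plane of S2 at x and is 0 on the normal
   line, so the trace over an orthonormal basis of the tangent plane equals the
   trace over the canonical basis of R^3. *)
Definition grad_sq (R : realType) (n : nat) (h : 'rV[R]_n -> 'M[R]_n)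
    (u : 'rV[R]_3 -> 'rV[R]_n) (x : 'rV[R]_3) : R :=
  \sum_(i < 3) bilin (h (u x))
    ('D_(delta_mx 0 i) (S2_ext u) x) ('D_(delta_mx 0 i) (S2_ext u) x).

Definition spherical (R : realType) (theta phi : R) : 'rV[R]_3 :=
  \row_(i < 3) [:: sin theta * cos phi; sin theta * sin phi; cos theta]`_i.

(* Integral for the area measure of the round unit sphere *)
Definition S2_integral (R : realType) (f : 'rV[R]_3 -> R) : R :=
  Rintegral (@lebesgue_measure R) `[0, pi] (fun theta =>
    Rintegral (@lebesgue_measure R) `[0, 2 * pi] (fun phi =>
      f (spherical theta phi) * sin theta)).

Definition energy (R : realType) (n : nat) (h : 'rV[R]_n -> 'M[R]_n)
    (u : 'rV[R]_3 -> 'rV[R]_n) : R :=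
  2^-1 * S2_integral (grad_sq h u).

Definition smooth_map (R : realType) (n : nat) (N : set 'rV[R]_n)
    (u : 'rV[R]_3 -> 'rV[R]_n) : Prop :=
  smooth_on (@S2 R) u /\ forall x, S2 x -> N (u x).

(* A smooth family u_s = w (., s), |s| < e, of maps S2 -> N with u_0 = u *)
Definition variation (R : realType) (n : nat) (N : set 'rV[R]_n)
    (u : 'rV[R]_3 -> 'rV[R]_n) (e : R)
    (w : 'rV[R]_3 * R^o -> 'rV[R]_n) : Prop :=
  [/\ smooth_on (@S2 R `*` [set s : R^o | - e < s < e]) w,
      forall x s, S2 x -> - e < s < e -> N (w (x, s)) &
      forall x, S2 x -> w (x, 0) = u x].

Definition harmonic (R : realType) (n : nat) (N : set 'rV[R]_n)
    (h : 'rV[R]_n -> 'M[R]_n) (u : 'rV[R]_3 -> 'rV[R]_n) : Prop :=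
  smooth_map N u /\
  forall (e : R) (w : 'rV[R]_3 * R^o -> 'rV[R]_n), 0 < e -> variation N u e w ->
    is_derive (0 : R^o) 1 (fun s : R^o => energy h (fun x => w (x, s)) : R^o) 0.

Definition energy_set (R : realType) (n : nat) (N : set 'rV[R]_n)
    (h : 'rV[R]_n -> 'M[R]_n) : set R :=
  [set energy h u | u in [set u | harmonic N h u]].

Definition discrete_set (R : realType) (A : set R) : Prop := A `<=` isolated A.

(* S^2 x (-1,1) in R^3 x R *)
Definition S2xI (R : realType) : set 'rV[R]_(3 + 1) :=
  [set p | S2 (lsubmx p) /\ -1 < (rsubmx p : 'rV[R]_1) 0 0 < 1].

(* psi(t) (ds^2 + dt^2): ds^2 + dt^2 is induced by the Euclidean metric of
   R^3 x R. *)
Definition conformal_metric (R : realType) (psi : R -> R)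
    (p : 'rV[R]_(3 + 1)) : 'M[R]_(3 + 1) :=
  (psi ((rsubmx p : 'rV[R]_1) 0 0))%:M.

(* Main.v *)
Require Import Defs.
From mathcomp Require Import all_boot all_order all_algebra.
From mathcomp Require Import all_classical all_reals all_analysis.
From mathcomp Require Import ring lra.
Import Order.TTheory GRing.Theory Num.Theory.
Import numFieldNormedType.Exports.
Local Open Scope classical_set_scope.
Local Open Scope ring_scope.

Set Implicit Arguments.
Unset Strict Implicit.
Unset Printing Implicit Defensive.

(** The harmonic spheres are the slices [x |-> (x, t)] over the critical points
    [t] of [psi] ([harmonic_slice]); the slice over [t] has energy
    [4 * pi * psi t] ([energy_slice]). Between two consecutive zeros of
    [sin (1/t)] enclosing an interval where it is positive, [psi] is 1 at both
    ends and larger than 1 inside, so Rolle's theorem gives a critical point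
    with [psi > 1]; since [psi - 1] is at most [expR (- 1/t^2)], these critical
    values tend to 1 ([critical_values]), and the energies accumulate at
    [4 * pi] without being equal to it.

    That a slice over a critical point [t0] is harmonic means that the energy
    of every variation [w (x, s) = (X, tau)] of it is stationary at [s = 0].
    The energy density is expanded pointwise ([density_expansion]): it is the
    constant [2 psi(t0)], plus [2 psi(t0)] times the tangential divergence of
    [X] minus [2 <x, X>], plus a remainder. The last two terms behave as
    follows. The second one has zero integral for each [s], by the divergence
    theorem on the sphere ([sphere_divergence]): it expresses that the identity
    of the sphere is harmonic, and the use of the finite difference [X - x]
    instead of the velocity of the variation makes it exact in [s]. The
    remainder contains squares of [X - x] and of the variation of the
    differential, which are of order [s^2], and the product of a bounded factor
    with [psi(tau) - psi(t0)], which is [o(s)] because [psi'(t0) = 0] and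
    [tau - t0] is of order [s]. Compactness of the sphere makes these estimates
    uniform, so that the energy is [4 * pi * psi t0 + o(s)]
    ([slice_stationary]).

    For the last assertion [psi] is [1 + expR (- 1/t^2) * sin (1/t)] on the
    whole line. It is smooth at 0 because the functions
    [expR (- 1/t^2) * (P(1/t) * sin (1/t) + Q(1/t) * cos (1/t))], with [P] and
    [Q] polynomials, all vanish to second order at 0 and are stable under
    derivation ([is_derive_flat]). Then [psi'(0) = 0], so [4 * pi] is itself an
    energy, and it is not isolated. *)

(** * Differential calculus by coordinates *)

Section calculus.
Context {R : realType}.
Implicit Types (V W : normedModType R).

Lemma cvg_bigsum (T I : Type) (F : set_system T) (W : normedModType R)
    (r : seq I) (f : I -> T -> W) (l : I -> W) : Filter F ->
  (forall i, f i x @[x --> F] --> l i) ->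
  (\sum_(i <- r) f i x) @[x --> F] --> \sum_(i <- r) l i.
Proof.
move=> FF fl.
by apply: cvg_big => [|i _]; [exact: add_continuous|exact: fl].
Qed.

Lemma continuous_of_fst (f : R -> R) :
  continuous f -> continuous (fun p : R * R => f p.1).
Proof.
move=> cf p; apply: (@continuous_comp _ _ _ (fun q : R * R => q.1) f).
  exact: cvg_fst.
exact: cf.
Qed.

Lemma continuous_of_snd (f : R -> R) :
  continuous f -> continuous (fun p : R * R => f p.2).
Proof.
move=> cf p; apply: (@continuous_comp _ _ _ (fun q : R * R => q.2) f).
  exact: cvg_snd.
exact: cf.
Qed.

Lemma continuous_row n (T : topologicalType) (f : T -> 'rV[R]_n) x :
  (forall j, (fun y => f y 0 j) @ x --> f x 0 j) -> f @ x --> f x.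
Proof.
move=> cf; rewrite (_ : f = fun y => \sum_(j < n) f y 0 j *: delta_mx 0 j).
  apply: cvg_bigsum => j.
  by apply: cvgZr_tmp; exact: cf.
by apply/funext => y; exact: row_sum_delta.
Qed.

Lemma differentiable_row n V (f : V -> 'rV[R]_n) x :
  (forall j, differentiable (fun y => f y 0 j : R) x) -> differentiable f x.
Proof.
move=> df; rewrite (_ : f = \sum_(j < n) (fun y => f y 0 j *: delta_mx 0 j)).
  by apply: differentiable_sum => j; exact: differentiableZl.
by apply/funext => y; rewrite fct_sumE; exact: row_sum_delta.
Qed.

Lemma differentiable_entry n V (f : V -> 'rV[R]_n) x j :
  differentiable f x -> differentiable (fun y => f y 0 j : R) x.
Proof.
move=> df; apply: (@differentiable_comp _ _ _ _ f (fun v : 'rV[R]_n => v 0 j : R)) => //.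
exact: differentiable_coord.
Qed.

Lemma derive_entry n V (f : V -> 'rV[R]_n) x v j :
  differentiable f x -> ('D_v f x) 0 j = 'D_v (fun y => f y 0 j : R) x.
Proof.
by move=> df; rewrite derive_mx ?mxE//; exact: diff_derivable.
Qed.

Lemma near_eq_differentiable V W (f g : V -> W) x :
  (\forall y \near x, f y = g y) -> differentiable f x -> differentiable g x.
Proof.
move=> fg df.
have gx : g x = f x by rewrite (nbhs_singleton fg).
have [dc /eqaddoP fo] := (diff_locallyP x f).1 df.
have go : g \o shift x = cst (g x) + 'd f x +o_ 0 id.
  apply/eqaddoP => e e0; have := fo e e0.
  have : \forall h \near (0 : V), f (h + x) = g (h + x).
    by move: fg; rewrite (near_shift 0) /= subr0.
  apply: filterS2 => h /= fgh; rewrite !fctE /= -fgh gx; exact.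
have E := diff_unique dc go.
by apply/diff_locallyP; rewrite E.
Qed.

Lemma derive_comp V W (U : normedModType R) (f : U -> V) (g : V -> W) x v :
  differentiable f x -> differentiable g (f x) ->
  'D_v (g \o f) x = 'D_('D_v f x) g (f x).
Proof.
move=> df dg; have dgf : differentiable (g \o f) x.
  exact: differentiable_comp.
by rewrite (deriveE v dgf) (deriveE v df) (deriveE _ dg) (diff_comp df dg).
Qed.

Lemma derive_delta n W (f : 'rV[R]_n -> W) x v : differentiable f x ->
  'D_v f x = \sum_(j < n) v 0 j *: 'D_(delta_mx 0 j) f x.
Proof.
move=> df; rewrite deriveE// {1}(row_sum_delta v) linear_sum.
by apply: eq_bigr => j _; rewrite linearZ deriveE.
Qed.

Lemma is_derive_bigsum n V W (h : 'I_n -> V -> W) (dh : 'I_n -> W) x v :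
  (forall i, is_derive x v (h i) (dh i)) ->
  is_derive x v (fun y => \sum_(i < n) h i y) (\sum_(i < n) dh i).
Proof.
move=> Dh; rewrite (_ : (fun y => _) = \sum_(i < n) h i).
  exact: is_derive_sum.
by apply/funext => y; rewrite fct_sumE.
Qed.

Lemma is_derive_mul V (f g : V -> R) x v (df dg : R) :
  is_derive x v f df -> is_derive x v g dg ->
  is_derive x v (fun y => f y * g y) (df * g x + f x * dg).
Proof.
move=> Df Dg; have Dfg := is_deriveM Df Dg.
by apply: (is_derive_eq Dfg); rewrite addrC; congr (_ + _); exact: mulrC.
Qed.

Lemma is_derive_curve n (G : 'rV[R]_n -> R) (c : R -> 'rV[R]_n)
    (dc : 'I_n -> R) (t : R) :
  (forall j, is_derive t 1 (fun s => c s 0 j) (dc j)) ->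
  differentiable G (c t) ->
  is_derive t 1 (fun s => G (c s))
    (\sum_(j < n) dc j * 'D_(delta_mx 0 j) G (c t)).
Proof.
move=> Dc dG.
have dfc : differentiable c t.
  by apply: differentiable_row => j; apply/derivable1_diffP; have [] := Dc j.
apply: DeriveDef.
  by apply: diff_derivable; exact: (differentiable_comp dfc dG).
rewrite (derive_comp (1 : R) dfc dG) derive_delta//; apply: eq_bigr => j _.
by rewrite derive_entry//; congr (_ * _); apply: derive_val.
Qed.

End calculus.

(** * Integrals depending on a parameter *)

Section iterated_integral.
Context {R : realType}.
Local Notation mu := (@lebesgue_measure R).
Implicit Types (a b c d x y : R) (f : R -> R) (g : R -> R -> R).

Lemma continuous_integrable a b f :
  continuous f -> mu.-integrable `[a, b] (EFin \o f).
Proof.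
move=> cf; apply: continuous_compact_integrable; first exact: segment_compact.
exact: continuous_subspaceT.
Qed.

Lemma continuous_partial g x :
  continuous (fun p : R * R => g p.1 p.2) -> continuous (g x).
Proof.
move=> cg y; apply: (@continuous_comp _ _ _ (fun y => (x, y))
  (fun p : R * R => g p.1 p.2)); last exact: cg.
exact: (cvg_pair (cvg_cst x) cvg_id).
Qed.

(** Compactness of [[c, d]] makes the continuity in the first variable uniform
    in the second. *)
Lemma near_uniform g c d x0 (e : R) :
  continuous (fun p : R * R => g p.1 p.2) -> 0 < e ->
  \forall x \near x0, forall y, y \in `[c, d] -> `|g x0 y - g x y| <= e.
Proof.
move=> cg e0.
have /compact_near_coveringP ncov := @segment_compact R c d.
apply: (ncov R (nbhs x0) (fun x y => `|g x0 y - g x y| <= e)) => y _.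
have e20 : 0 < e / 2 by rewrite divr_gt0.
have /cvgrPdist_le/(_ _ e20) cxy := cg (x0, y).
have /cvgrPdist_le/(_ _ e20) cx0 := @continuous_partial g x0 cg y.
have [[A B] /= [nA nB] AB] := cxy.
exists (B `&` [set y' | `|g x0 y - g x0 y'| <= e / 2], A).
  by split => //=; exact: filterI.
move=> [y' x] /= [[By' le1] Ax].
have := AB (x, y') (conj Ax By') => /= le2.
rewrite (splitr e) -(subrKA (g x0 y)) (le_trans (ler_normD _ _))// lerD//.
by rewrite distrC.
Qed.

Lemma continuous_param_integral g c d :
  continuous (fun p : R * R => g p.1 p.2) ->
  continuous (fun x => \int[mu]_(y in `[c, d]) g x y).
Proof.
move=> cg x0; have [dc|cd] := ltP d c.
  rewrite set_itv_ge ?bnd_simp -?ltNge//.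
  by under eq_fun do rewrite Rintegral_set0; exact: cvg_cst.
apply/cvgrPdist_le => e e0.
have k0 : 0 < e / (d - c + 1) by rewrite divr_gt0// ltr_pwDr// subr_ge0.
near=> x.
rewrite -RintegralB//; [|exact/continuous_integrable/continuous_partial..].
have ci : continuous (fun y => g x0 y - g x y).
  by move=> y; apply: cvgB; exact: continuous_partial.
apply: le_trans (le_normr_Rintegral _ _) _ => //.
  exact: continuous_integrable.
apply: (@le_trans _ _ (\int[mu]_(y in `[c, d]) (e / (d - c + 1)))).
  apply: le_Rintegral => //.
  - apply: continuous_integrable => y; apply: cvg_norm; exact: ci.
  - by apply: continuous_integrable => y; exact: cvg_cst.
  - by move=> y yi; move: y yi; near: x; exact: near_uniform.
rewrite Rintegral_cst//= lebesgue_measure_itv/= lte_fin.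
case: ltP => _ /=; last by rewrite mulr0 ltW.
rewrite -[leRHS]mulr1 -mulrA ler_pM2l// mulrC ler_pdivrMr ?mul1r.
  by rewrite lerDl.
by rewrite ltr_pwDr// subr_ge0.
Unshelve. all: by end_near. Qed.

Lemma Rintegral_FTC2 a b (F f : R -> R) : a <= b ->
  (forall x : R, is_derive x 1 F (f x)) -> continuous f ->
  \int[mu]_(x in `[a, b]) f x = F b - F a.
Proof.
rewrite le_eqVlt => /predU1P[-> _ _|ab dF cf].
  by rewrite set_itv1 Rintegral_set1 subrr.
have cF : continuous F.
  move=> x; apply: differentiable_continuous; apply/derivable1_diffP.
  by have [] := dF x.
rewrite /Rintegral (@continuous_FTC2 _ f F)//.
- exact: continuous_subspaceT.
- split.
  + by move=> x _; have [] := dF x.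
  + by apply: cvg_at_right_filter; exact: cF.
  + by apply: cvg_at_left_filter; exact: cF.
- by move=> x _; rewrite derive1E; apply: derive_val.
Qed.

(** Near [x0] the derivative [dg] is dominated by [`|dg x0 y| + 1], uniformly in
    [y], so dominated convergence applies. *)
Lemma is_derive_param_integral g dg c d x0 :
  (forall x y : R, is_derive x 1 (g ^~ y) (dg x y)) ->
  (forall x, continuous (g x)) ->
  continuous (fun p : R * R => dg p.1 p.2) ->
  is_derive x0 1 (fun x => \int[mu]_(y in `[c, d]) g x y)
                 (\int[mu]_(y in `[c, d]) dg x0 y).
Proof.
move=> Dg cg cdg.
have [e /= e0 De] : \forall x \near x0, forall y, y \in `[c, d] ->
  `|dg x0 y - dg x y| <= 1 by exact: near_uniform.
have d1E x y : partial1of2 g x y = dg x y.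
  by rewrite partial1of2E; apply: derive_val.
have x0I : `](x0 - e), (x0 + e)[%classic x0 by rewrite /= in_itv/= ltrBlDr ltrDl e0.
have bnd x y : `](x0 - e), (x0 + e)[%classic x -> `[c, d]%classic y ->
    `|partial1of2 g x y| <= `|dg x0 y| + 1.
  rewrite /= !in_itv/= d1E => xI yI.
  rewrite -lerBlDl (le_trans (lerB_dist _ _))// distrC De//=.
  by rewrite distrC ltr_distl.
have ci : mu.-integrable `[c, d] (EFin \o (fun y => `|dg x0 y| + 1)).
  apply: continuous_integrable => y; apply: cvgD; last exact: cvg_cst.
  by apply: cvg_norm; exact: continuous_partial.
have C := @cvg_differentiation_under_integral R _ _ mu g `[c, d]%classic
  (measurable_itv _) x0 _ _ x0I (fun x _ => continuous_integrable _ _ (cg x))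
  (fun x y _ _ => @ex_derive _ _ _ _ _ _ _ (Dg x y))
  _ (fun y => addr_ge0 (normr_ge0 _) ler01) ci bnd.
have Q : (fun h : R => h^-1 *: (((fun x => \int[mu]_(y in `[c, d]) g x y) \o
    shift x0) (h *: 1) - \int[mu]_(y in `[c, d]) g x0 y)) =
  (fun h => h^-1 *: (\int[mu]_(y in `[c, d]) g (h + x0) y -
    \int[mu]_(y in `[c, d]) g x0 y)).
  by apply/funext => h /=; rewrite [h *: 1]mulr1.
have E : \int[mu]_(y in `[c, d]) dg x0 y =
  \int[mu]_(y in `[c, d]) partial1of2 g x0 y.
  by apply: eq_Rintegral => y _; rewrite d1E.
apply: DeriveDef.
  by apply/cvg_ex; eexists; rewrite Q; exact: C.
by rewrite E; apply/cvg_lim => //; rewrite Q.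
Qed.

End iterated_integral.

(** * Integration on the sphere *)

Section sphere_integral.
Context {R : realType}.
Local Notation mu := (@lebesgue_measure R).
Implicit Types (f g : 'rV[R]_3 -> R).

Lemma sphericalE (theta phi : R) :
  [/\ spherical theta phi 0 0 = sin theta * cos phi,
      spherical theta phi 0 1 = sin theta * sin phi &
      spherical theta phi 0 2 = cos theta].
Proof. by rewrite !mxE. Qed.

Lemma sum3 (V : nmodType) (F : 'I_3 -> V) : \sum_(i < 3) F i = F 0 + F 1 + F 2.
Proof.
rewrite !big_ord_recl big_ord0 addr0 addrA.
by congr (F _ + F _ + F _); apply/val_inj.
Qed.

Lemma ord3P (P : 'I_3 -> Prop) : P 0 -> P 1 -> P 2 -> forall i, P i.
Proof.
move=> P0 P1 P2 [[|[|[|//]]] i3].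
- by rewrite (_ : Ordinal i3 = 0)//; exact/val_inj.
- by rewrite (_ : Ordinal i3 = 1)//; exact/val_inj.
- by rewrite (_ : Ordinal i3 = 2)//; exact/val_inj.
Qed.

Lemma S2_dot (x : 'rV[R]_3) : S2 x <-> \sum_i x 0 i ^+ 2 = 1.
Proof.
rewrite /S2/= /enorm; split=> [h|->]; last exact: sqrtr1.
rewrite -[LHS]sqr_sqrtr ?h ?expr1n//.
by apply: sumr_ge0 => i _; exact: sqr_ge0.
Qed.

Lemma spherical_S2 (theta phi : R) : S2 (spherical theta phi).
Proof.
apply/S2_dot; have [e0 e1 e2] := sphericalE theta phi.
rewrite sum3 e0 e1 e2 !exprMn -mulrDr cos2Dsin2 mulr1 addrC.
exact: cos2Dsin2.
Qed.

Lemma continuous_spherical :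
  continuous (fun p : R * R => spherical p.1 p.2).
Proof.
have cs1 := continuous_of_fst (@continuous_sin R).
have cc1 := continuous_of_fst (@continuous_cos R).
have cs2 := continuous_of_snd (@continuous_sin R).
have cc2 := continuous_of_snd (@continuous_cos R).
move=> p; apply: continuous_row; apply: ord3P.
- rewrite (_ : (fun y : R * R => _) = fun y : R * R => sin y.1 * cos y.2).
    by have [-> _ _] := sphericalE p.1 p.2; apply: cvgM; [exact: cs1|exact: cc2].
  by apply/funext => y; have [-> _ _] := sphericalE y.1 y.2.
- rewrite (_ : (fun y : R * R => _) = fun y : R * R => sin y.1 * sin y.2).
    by have [_ -> _] := sphericalE p.1 p.2; apply: cvgM; [exact: cs1|exact: cs2].
  by apply/funext => y; have [_ -> _] := sphericalE y.1 y.2.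
- rewrite (_ : (fun y : R * R => _) = fun y : R * R => cos y.1).
    by have [_ _ ->] := sphericalE p.1 p.2; exact: cc1.
  by apply/funext => y; have [_ _ ->] := sphericalE y.1 y.2.
Qed.

(** Continuity of the restriction to the sphere, read in the coordinates that
    define the integral. *)
Definition S2_continuous f :=
  continuous (fun p : R * R => f (spherical p.1 p.2)).

Lemma S2_continuousD f g : S2_continuous f -> S2_continuous g ->
  S2_continuous (fun x => f x + g x).
Proof. by move=> cf cg p; apply: cvgD; [exact: cf|exact: cg]. Qed.

Lemma S2_continuousM f g : S2_continuous f -> S2_continuous g ->
  S2_continuous (fun x => f x * g x).
Proof. by move=> cf cg p; apply: cvgM; [exact: cf|exact: cg]. Qed.

Lemma S2_continuous_cst (c : R) : S2_continuous (fun=> c).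
Proof. by move=> p; exact: cvg_cst. Qed.

Lemma S2_continuous_entry i : S2_continuous (fun x => x 0 i).
Proof.
move=> p; apply: (@continuous_comp _ _ _ (fun p : R * R => spherical p.1 p.2)
  (fun x : 'rV[R]_3 => x 0 i)); first exact: continuous_spherical.
exact: coord_continuous.
Qed.

Lemma S2_continuous_sum n (F : 'I_n -> 'rV[R]_3 -> R) :
  (forall i, S2_continuous (F i)) -> S2_continuous (fun x => \sum_i F i x).
Proof.
by move=> cF p; apply: cvg_bigsum => i; exact: cF.
Qed.

Lemma S2_continuous_near f :
  (forall x, S2 x -> {for x, continuous f}) -> S2_continuous f.
Proof.
move=> cf p; apply: (@continuous_comp _ _ _ (fun p : R * R => spherical p.1 p.2) f).
  exact: continuous_spherical.
by apply: cf; exact: spherical_S2.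
Qed.

Lemma eq_S2_continuous f g :
  (forall x, S2 x -> f x = g x) -> S2_continuous f -> S2_continuous g.
Proof.
move=> fg; rewrite /S2_continuous.
suff -> : (fun p : R * R => f (spherical p.1 p.2)) =
  (fun p : R * R => g (spherical p.1 p.2)) by [].
by apply/funext => p; exact/fg/spherical_S2.
Qed.

Lemma eq_S2_integral f g :
  (forall x, S2 x -> f x = g x) -> S2_integral f = S2_integral g.
Proof.
move=> fg; apply: eq_Rintegral => t _; apply: eq_Rintegral => p _.
by rewrite fg//; exact: spherical_S2.
Qed.

Let cont2 f : S2_continuous f ->
  continuous (fun p : R * R => f (spherical p.1 p.2) * sin p.1).
Proof.
move=> cf p; apply: cvgM; first exact: cf.
exact: (continuous_of_fst (@continuous_sin R)).
Qed.

Let int1 f theta : S2_continuous f -> mu.-integrable `[0, 2 * pi]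
  (EFin \o (fun phi => f (spherical theta phi) * sin theta)).
Proof.
move=> cf; apply: continuous_integrable.
exact: (@continuous_partial _ (fun theta phi => f (spherical theta phi) *
  sin theta) theta (cont2 cf)).
Qed.

Let int2 f : S2_continuous f -> mu.-integrable `[0, pi]
  (EFin \o (fun theta => \int[mu]_(phi in `[0, 2 * pi])
                            (f (spherical theta phi) * sin theta))).
Proof.
move=> cf; apply: continuous_integrable.
exact: (@continuous_param_integral _ (fun theta phi =>
  f (spherical theta phi) * sin theta) 0 (2 * pi) (cont2 cf)).
Qed.

Lemma S2_integralD f g : S2_continuous f -> S2_continuous g ->
  S2_integral (fun x => f x + g x) = S2_integral f + S2_integral g.
Proof.
move=> cf cg; rewrite /S2_integral -RintegralD//; [|exact: int2..].
apply: eq_Rintegral => t _; rewrite -RintegralD//; [|exact: int1..].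
by apply: eq_Rintegral => p _; rewrite mulrDl.
Qed.

Lemma S2_integralZ f (c : R) : S2_continuous f ->
  S2_integral (fun x => c * f x) = c * S2_integral f.
Proof.
move=> cf; rewrite /S2_integral -RintegralZl//; last exact: int2.
apply: eq_Rintegral => t _; rewrite -RintegralZl//; last exact: int1.
by apply: eq_Rintegral => p _; rewrite mulrA.
Qed.

Lemma S2_integral_cst (c : R) : S2_integral (fun=> c) = 4 * pi * c.
Proof.
rewrite /S2_integral; under eq_Rintegral => t _.
  rewrite Rintegral_cst//= lebesgue_measure_itv/= lte_fin mulr_gt0 ?pi_gt0//=.
  over.
have dF (t : R) : is_derive t 1 (fun t : R => - (2 * pi * c * cos t))
    (2 * pi * c * sin t).
  by apply: is_derive_eq; rewrite -scalerN opprK.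
have cf : continuous (fun t : R => 2 * pi * c * sin t).
  by move=> t; apply: cvgM; [exact: cvg_cst|exact: continuous_sin].
have := Rintegral_FTC2 (pi_ge0 R) dF cf; rewrite cospi cos0 => E.
transitivity (\int[mu]_(t in `[0, pi]) (2 * pi * c * sin t)).
  by apply: eq_Rintegral => t _ /=; rewrite subr0; ring.
by rewrite E; ring.
Qed.

Lemma S2_integral_le f g : S2_continuous f -> S2_continuous g ->
  (forall x, S2 x -> f x <= g x) -> S2_integral f <= S2_integral g.
Proof.
move=> cf cg fg; apply: le_Rintegral => //; [exact: int2..|].
move=> t /=; rewrite in_itv/= => t0pi.
apply: le_Rintegral => //; [exact: int1..|move=> p _].
by apply: ler_wpM2r; [exact: sin_ge0_pi|exact/fg/spherical_S2].
Qed.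

Lemma S2_integral_bound f (e : R) : S2_continuous f ->
  (forall x, S2 x -> `|f x| <= e) -> `|S2_integral f| <= 4 * pi * e.
Proof.
move=> cf fe; rewrite ler_norml -mulrN -!S2_integral_cst; apply/andP; split;
  apply: S2_integral_le => //; do ?exact: S2_continuous_cst;
  by move=> x /fe; rewrite ler_norml => /andP[].
Qed.

End sphere_integral.

(** * The divergence theorem on the sphere *)

Section sphere_divergence.
Context {R : realType}.
Local Notation mu := (@lebesgue_measure R).
Local Notation "'d_ j f" := ('D_(delta_mx 0 j) f)
  (at level 10, j at level 8, f at level 9).

(** The unit vectors along the meridians and along the parallels. *)
Definition e_theta (theta phi : R) (i : 'I_3) : R :=
  [:: cos theta * cos phi; cos theta * sin phi; - sin theta]`_i.

Definition e_phi (phi : R) (i : 'I_3) : R := [:: - sin phi; cos phi; 0]`_i.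

Lemma is_derive_spherical_theta (theta phi : R) j :
  is_derive theta 1 (fun t => spherical t phi 0 j) (e_theta theta phi j).
Proof.
elim/ord3P: j.
- rewrite (_ : (fun t => _) = fun t : R => sin t * cos phi).
    apply: is_derive_eq; rewrite scaler0 add0r; exact: mulrC.
  by apply/funext => t; have [] := sphericalE t phi.
- rewrite (_ : (fun t => _) = fun t : R => sin t * sin phi).
    apply: is_derive_eq; rewrite scaler0 add0r; exact: mulrC.
  by apply/funext => t; have [] := sphericalE t phi.
- rewrite (_ : (fun t => _) = fun t : R => cos t); first exact: is_derive_cos.
  by apply/funext => t; have [] := sphericalE t phi.
Qed.

Lemma is_derive_spherical_phi (theta phi : R) j :
  is_derive phi 1 (fun t => spherical theta t 0 j) (sin theta * e_phi phi j).
Proof.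
elim/ord3P: j.
- rewrite (_ : (fun t => _) = fun t : R => sin theta * cos t).
    by apply: is_derive_eq.
  by apply/funext => t; have [] := sphericalE theta t.
- rewrite (_ : (fun t => _) = fun t : R => sin theta * sin t).
    by apply: is_derive_eq.
  by apply/funext => t; have [] := sphericalE theta t.
- rewrite (_ : (fun t => _) = fun t : R => cos theta).
    by rewrite [e_phi _ _]/= mulr0; exact: is_derive_cst.
  by apply/funext => t; have [] := sphericalE theta t.
Qed.

Lemma is_derive_e_theta (theta phi : R) i :
  is_derive theta 1 (fun t => e_theta t phi i) (- spherical theta phi 0 i).
Proof.
have [e0 e1 e2] := sphericalE theta phi.
elim/ord3P: i; rewrite ?e0 ?e1 ?e2 /e_theta/=.
- apply: is_derive_eq; rewrite scaler0 add0r -mulNr; exact: mulrC.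
- apply: is_derive_eq; rewrite scaler0 add0r -mulNr; exact: mulrC.
- by apply: is_derive_eq.
Qed.

Lemma is_derive_e_phi (theta phi : R) i :
  is_derive phi 1 (fun t => e_phi t i)
    (- (sin theta * spherical theta phi 0 i + cos theta * e_theta theta phi i)).
Proof.
have [e0 e1 e2] := sphericalE theta phi.
have tt := cos2Dsin2 theta.
elim/ord3P: i; rewrite ?e0 ?e1 ?e2 /e_theta /e_phi/=.
- by apply: is_derive_eq; rewrite -[cos phi in LHS]mulr1 -tt; ring.
- by apply: is_derive_eq; rewrite -[sin phi in LHS]mulr1 -tt; ring.
- by apply: is_derive_eq; ring.
Qed.

(** Both sides are the orthogonal projection onto the tangent plane: the radial
    vector, [e_theta] and [e_phi] form an orthonormal frame. *)
Lemma spherical_frame (theta phi : R) (i j : 'I_3) :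
  (i == j)%:R - spherical theta phi 0 i * spherical theta phi 0 j =
  e_theta theta phi i * e_theta theta phi j + e_phi phi i * e_phi phi j.
Proof.
have [e0 e1 e2] := sphericalE theta phi.
have st : sin theta ^+ 2 = 1 - cos theta ^+ 2.
  by rewrite -(cos2Dsin2 theta) addrAC subrr add0r.
have sp : sin phi ^+ 2 = 1 - cos phi ^+ 2.
  by rewrite -(cos2Dsin2 phi) addrAC subrr add0r.
by elim/ord3P: i; elim/ord3P: j; rewrite ?e0 ?e1 ?e2 /e_theta /e_phi/=;
  ring: st sp.
Qed.

Lemma continuous_e_theta i :
  continuous (fun p : R * R => e_theta p.1 p.2 i).
Proof.
have cs1 := continuous_of_fst (@continuous_sin R).
have cc1 := continuous_of_fst (@continuous_cos R).
have cs2 := continuous_of_snd (@continuous_sin R).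
have cc2 := continuous_of_snd (@continuous_cos R).
elim/ord3P: i => p.
- by apply: cvgM; [exact: cc1|exact: cc2].
- by apply: cvgM; [exact: cc1|exact: cs2].
- by apply: cvgN; exact: cs1.
Qed.

Lemma continuous_e_phi i : continuous (fun phi : R => e_phi phi i).
Proof.
elim/ord3P: i => p.
- by apply: cvgN; exact: continuous_sin.
- exact: continuous_cos.
- exact: cvg_cst.
Qed.

Lemma spherical_2pi (theta : R) : spherical theta (2 * pi) = spherical theta 0.
Proof.
have [e0 e1 e2] := sphericalE theta (2 * pi).
have [f0 f1 f2] := sphericalE theta 0.
have two : 2 * pi = 0 + pi *+ 2 :> R by rewrite add0r mulr_natl.
have c2 : cos (2 * pi) = cos 0 :> R by rewrite two cosD2pi.
have s2 : sin (2 * pi) = sin 0 :> R by rewrite two sinD2pi.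
by apply/rowP; elim/ord3P; rewrite ?e0 ?e1 ?e2 ?f0 ?f1 ?f2 ?c2 ?s2.
Qed.

(** The left-hand side is the divergence density; on the right are the
    derivatives of [s * \sum_i a i * g i] along a meridian and of
    [\sum_i b i * g i] along a parallel, for [a = e_theta], [b = e_phi],
    [s = sin theta] and [c = cos theta]. *)
Let frame_identity (s c : R) (a b x g : 'I_3 -> R) (D : 'I_3 -> 'I_3 -> R) :
  (\sum_i \sum_j (a i * a j + b i * b j) * D i j - 2 * \sum_i x i * g i) * s =
  c * (\sum_i a i * g i)
  + s * (\sum_i (a i * (\sum_j a j * D i j) - x i * g i))
  + \sum_i (b i * (\sum_j s * b j * D i j) - (s * x i + c * a i) * g i).
Proof. by rewrite !sum3; ring. Qed.

(** In spherical coordinates the integrand times [sin theta] is the sum of the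
    [theta]-derivative of [sin theta * <G, e_theta>], which vanishes at both
    poles, and of the [phi]-derivative of the periodic function [<G, e_phi>].
    The field [G] may have a normal component, which contributes twice its
    length [<x, G>] to the tangential divergence: this is the last term. *)
Theorem sphere_divergence (G : 'I_3 -> 'rV[R]_3 -> R) :
  (forall i x, S2 x -> differentiable (G i) x) ->
  (forall i j, S2_continuous ('d_j (G i))) ->
  S2_integral (fun x =>
    \sum_i \sum_j ((i == j)%:R - x 0 i * x 0 j) * 'd_j (G i) x
    - 2 * \sum_i x 0 i * G i x) = 0.
Proof.
move=> dG cDG.
pose g i theta phi := G i (spherical theta phi).
pose Dt i theta phi :=
  \sum_j e_theta theta phi j * 'd_j (G i) (spherical theta phi).
pose Dp i theta phi :=
  \sum_j (sin theta * e_phi phi j) * 'd_j (G i) (spherical theta phi).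
have gt i (theta phi : R) : is_derive theta 1 (g i ^~ phi) (Dt i theta phi).
  apply: is_derive_curve; last exact/dG/spherical_S2.
  by move=> j; exact: is_derive_spherical_theta.
have gp i (theta phi : R) : is_derive phi 1 (g i theta) (Dp i theta phi).
  apply: is_derive_curve; last exact/dG/spherical_S2.
  by move=> j; exact: is_derive_spherical_phi.
pose p theta phi := sin theta * \sum_i e_theta theta phi i * g i theta phi.
pose q theta phi := \sum_i e_phi phi i * g i theta phi.
pose dp theta phi := cos theta * (\sum_i e_theta theta phi i * g i theta phi)
  + sin theta * \sum_i (e_theta theta phi i * Dt i theta phi
       - spherical theta phi 0 i * g i theta phi).
pose dq theta phi := \sum_i (e_phi phi i * Dp i theta phi
  - (sin theta * spherical theta phi 0 i + cos theta * e_theta theta phi i)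
    * g i theta phi).
have pt (theta phi : R) : is_derive theta 1 (p ^~ phi) (dp theta phi).
  apply: is_derive_mul; apply: is_derive_bigsum => i.
  rewrite (_ : _ - _ = - spherical theta phi 0 i * g i theta phi +
    e_theta theta phi i * Dt i theta phi); last by rewrite mulNr addrC.
  by apply: is_derive_mul; exact: is_derive_e_theta.
have qp (theta phi : R) : is_derive phi 1 (q theta) (dq theta phi).
  apply: is_derive_bigsum => i; rewrite addrC -mulNr.
  by apply: is_derive_mul; exact: is_derive_e_phi.
have cg i : continuous (fun z : R * R => g i z.1 z.2).
  apply: S2_continuous_near => x Sx; apply: differentiable_continuous.
  exact: dG.
have cs := continuous_of_fst (@continuous_sin R).
have cc := continuous_of_fst (@continuous_cos R).
have cep i := continuous_of_snd (@continuous_e_phi i).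
have cp : continuous (fun z : R * R => p z.1 z.2).
  move=> z; apply: cvgM; first exact: cs.
  by apply: cvg_bigsum => i; apply: cvgM; [exact: continuous_e_theta|exact: cg].
have cdp : continuous (fun z : R * R => dp z.1 z.2).
  move=> z; apply: cvgD; apply: cvgM; [exact: cc| |exact: cs|].
    by apply: cvg_bigsum => i; apply: cvgM; [exact: continuous_e_theta|exact: cg].
  apply: cvg_bigsum => i; apply: cvgB; apply: cvgM.
  - exact: continuous_e_theta.
  - apply: cvg_bigsum => j; apply: cvgM; first exact: continuous_e_theta.
    exact: cDG.
  - exact: S2_continuous_entry.
  - exact: cg.
have cdq : continuous (fun z : R * R => dq z.1 z.2).
  move=> z; apply: cvg_bigsum => i; apply: cvgB; apply: cvgM.
  - exact: cep.
  - apply: cvg_bigsum => j; apply: cvgM; last exact: cDG.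
    by apply: cvgM; [exact: cs|exact: cep].
  - apply: cvgD; apply: cvgM; [exact: cs|exact: S2_continuous_entry|exact: cc|].
    exact: continuous_e_theta.
  - exact: cg.
have -> : S2_integral (fun x =>
    \sum_i \sum_j ((i == j)%:R - x 0 i * x 0 j) * 'd_j (G i) x
    - 2 * \sum_i x 0 i * G i x) =
    \int[mu]_(theta in `[0, pi]) \int[mu]_(phi in `[0, 2 * pi]) dp theta phi.
  apply: eq_Rintegral => theta _.
  have -> : \int[mu]_(phi in `[0, 2 * pi]) dp theta phi =
      \int[mu]_(phi in `[0, 2 * pi]) (dp theta phi + dq theta phi).
    apply/esym; apply: etrans.
      apply: (@RintegralD _ _ _ mu _ (dp theta) (dq theta)) => //.
      - by apply: continuous_integrable; exact: (@continuous_partial _ dp theta cdp).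
      - by apply: continuous_integrable; exact: (@continuous_partial _ dq theta cdq).
    rewrite (Rintegral_FTC2 _ (qp theta)).
    - have e2 i : e_phi (2 * pi) i = e_phi 0 i :> R.
        have two : 2 * pi = 0 + pi *+ 2 :> R by rewrite add0r mulr_natl.
        by elim/ord3P: i; rewrite /e_phi/= ?two ?sinD2pi ?cosD2pi.
      rewrite (_ : q theta (2 * pi) = q theta 0) ?subrr ?addr0//.
      by apply: eq_bigr => i _; rewrite e2 /g spherical_2pi.
    - by rewrite mulr_ge0// pi_ge0.
    - exact: (@continuous_partial _ dq theta cdq).
  apply: eq_Rintegral => phi _.
  have -> : \sum_i \sum_j ((i == j)%:R - spherical theta phi 0 i *
      spherical theta phi 0 j) * 'd_j (G i) (spherical theta phi) =
    \sum_i \sum_j (e_theta theta phi i * e_theta theta phi j +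
      e_phi phi i * e_phi phi j) * 'd_j (G i) (spherical theta phi).
    by apply: eq_bigr => i _; apply: eq_bigr => j _; rewrite spherical_frame.
  exact: frame_identity.
have c0 theta : continuous (p theta) by exact: (@continuous_partial _ p theta cp).
have := Rintegral_FTC2 (pi_ge0 R) (fun theta =>
  is_derive_param_integral 0 (2 * pi) theta pt c0 cdp).
move=> ->; last exact: (@continuous_param_integral _ dp 0 (2 * pi) cdp).
have p0 theta : sin theta = 0 -> \int[mu]_(phi in `[0, 2 * pi]) p theta phi = 0.
  move=> s0; rewrite (_ : p theta = cst 0); last first.
    by apply/funext => phi; rewrite /p s0 mul0r.
  by rewrite Rintegral_cst//= mul0r.
by rewrite !p0 ?subrr// (sinpi,sin0).
Qed.
End sphere_divergence.

(** * The radial extension of a map on the sphere *)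

Section radial_extension.
Context {R : realType}.
Local Notation rV3 := 'rV[R]_3.

Definition sphere_proj (y : rV3) : rV3 := (enorm y)^-1 *: y.

Lemma enorm_ge0 n (x : 'rV[R]_n) : 0 <= enorm x.
Proof. exact: sqrtr_ge0. Qed.

Lemma enormZ n (a : R) (x : 'rV[R]_n) : enorm (a *: x) = `|a| * enorm x.
Proof.
rewrite /enorm -sqrtr_sqr -sqrtrM ?sqr_ge0//; congr Num.sqrt.
by rewrite mulr_sumr; apply: eq_bigr => i _; rewrite mxE exprMn.
Qed.

Lemma sphere_proj_id x : S2 x -> sphere_proj x = x.
Proof. by rewrite /sphere_proj => ->; rewrite invr1 scale1r. Qed.

Lemma sphere_proj_S2 y : enorm y != 0 -> S2 (sphere_proj y).
Proof.
move=> y0; rewrite /S2/= enormZ ger0_norm ?invr_ge0 ?enorm_ge0//.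
by rewrite mulVf.
Qed.

Lemma is_derive_enorm (x v : rV3) : S2 x ->
  differentiable (@enorm R 3) x /\ 'D_v (@enorm R 3) x = \sum_i x 0 i * v 0 i.
Proof.
move=> Sx.
pose q (y : rV3) : R := \sum_i y 0 i * y 0 i.
have qE y : q y = \sum_i y 0 i ^+ 2 by apply: eq_bigr => i _; rewrite expr2.
have qx : q x = 1 by rewrite qE; exact/S2_dot.
have dq : differentiable q x.
  rewrite (_ : q = \sum_i (fun y : rV3 => y 0 i * y 0 i)).
    apply: differentiable_sum => i.
    by apply: differentiableM; exact: differentiable_coord.
  by apply/funext => y; rewrite fct_sumE.
have ds : is_derive (q x) 1 (@Num.sqrt R) 2^-1.
  have := @is_derive1_sqrt R (q x); rewrite qx sqrtr1 mulr1; exact.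
have dsq : differentiable (@Num.sqrt R) (q x).
  by apply/derivable1_diffP; have [] := ds.
have Dq : is_derive x v q (\sum_i 2 * (x 0 i * v 0 i)).
  apply: is_derive_bigsum => i.
  have Di : is_derive x v (fun y : rV3 => y 0 i) (v 0 i).
    apply: DeriveDef; first by apply: diff_derivable; exact: differentiable_coord.
    by rewrite -(@derive_entry _ _ _ id) ?derive_id.
  by apply: (is_derive_eq (is_derive_mul Di Di)); ring.
have E : @enorm R 3 = Num.sqrt \o q.
  by apply/funext => y; rewrite /= qE.
split; first by rewrite E; exact: differentiable_comp.
rewrite E derive_comp//.
have [_ ->] := Dq.
rewrite deriveE// -[X in 'd _ _ X]mulr1.
rewrite -[X in 'd _ _ X]/((\sum_i 2 * (x 0 i * v 0 i)) *: (1 : R)).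
rewrite linearZ -deriveE//.
rewrite (@derive_val _ _ _ _ _ _ _ ds) -mulr_sumr.
by rewrite -[LHS]/(2 * _ * 2^-1) mulrAC mulfV ?mul1r// pnatr_eq0.
Qed.

Lemma derive_sphere_proj (x v : rV3) : S2 x ->
  differentiable sphere_proj x /\
  'D_v sphere_proj x = v - (\sum_i x 0 i * v 0 i) *: x.
Proof.
move=> Sx; have [dn Dn] := is_derive_enorm v Sx.
have nx : enorm x != 0 by rewrite (_ : enorm x = 1)// oner_eq0.
have dV : differentiable (fun y : rV3 => (enorm y)^-1) x.
  exact: differentiableV.
have DV : is_derive x v (fun y : rV3 => (enorm y)^-1) (- \sum_i x 0 i * v 0 i).
  apply: DeriveDef; first exact: diff_derivable.
  rewrite (deriveV nx); last exact: diff_derivable.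
  by rewrite Dn (_ : enorm x = 1)// expr1n invr1 scaleN1r.
have de j : differentiable (fun y : rV3 => (enorm y)^-1 * y 0 j) x.
  by apply: differentiableM => //; exact: differentiable_coord.
have pE j : (fun y : rV3 => sphere_proj y 0 j) = fun y => (enorm y)^-1 * y 0 j.
  by apply/funext => y; rewrite mxE.
have dp : differentiable sphere_proj x.
  by apply: differentiable_row => j; rewrite pE.
split=> //; apply/rowP => j; rewrite derive_entry// pE !mxE.
have Dj : is_derive x v (fun y : rV3 => y 0 j) (v 0 j).
  apply: DeriveDef; first by apply: diff_derivable; exact: differentiable_coord.
  by rewrite -(@derive_entry _ _ _ id) ?derive_id.
have [_ ->] := is_derive_mul DV Dj.
by rewrite (_ : enorm x = 1)// invr1 mul1r mulNr addrC.
Qed.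

(** Near the sphere the radial extension is any local extension composed with
    the radial projection, whose differential is the orthogonal projection onto
    the tangent plane. *)
Lemma derive_S2_ext n (u F : rV3 -> 'rV[R]_n) (x v : rV3) : S2 x ->
  (\forall y \near x, S2 y -> F y = u y) -> differentiable F x ->
  differentiable (S2_ext u) x /\
  'D_v (S2_ext u) x = 'D_(v - (\sum_i x 0 i * v 0 i) *: x) F x.
Proof.
move=> Sx Fu dF; have [dp Dp] := derive_sphere_proj v Sx.
have [dn _] := is_derive_enorm v Sx.
have cp := differentiable_continuous dp.
have px := sphere_proj_id Sx.
have nFu : \forall y \near x, (F \o sphere_proj) y = S2_ext u y.
  have near_n : \forall y \near x, enorm y != 0.
    have cn := differentiable_continuous dn.
    near=> y; rewrite gt_eqF//; near: y; apply: (cvgr_gt (enorm x)) => //.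
    by rewrite (_ : enorm x = 1)// ltr01.
  rewrite -px in Fu; have Fup := cp _ Fu.
  near=> y; rewrite /= /S2_ext -/(sphere_proj y).
  have : S2 (sphere_proj y) by apply: sphere_proj_S2; near: y.
  by near: y; exact: Fup.
have dFpx : differentiable F (sphere_proj x) by rewrite px.
have dFp : differentiable (F \o sphere_proj) x.
  exact: differentiable_comp dp dFpx.
split; first exact: near_eq_differentiable nFu dFp.
by rewrite -(near_eq_derive v nFu) (derive_comp v dp dFpx) px Dp.
Unshelve. all: by end_near. Qed.

End radial_extension.

(** * Families of maps depending on time *)

Section time_families.
Context {R : realType}.

Lemma entry_le_norm m n (M : 'M[R]_(m, n)) i j : `|M i j| <= `|M|.
Proof.
rewrite [leRHS]/Num.Def.normr/= mx_normrE.
exact: (le_bigmax _ (fun ij : 'I_m * 'I_n => `|M ij.1 ij.2|) (i, j)).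
Qed.

Section pairs.
Context {V : normedModType R}.

Lemma cvg_at_time (x : V) (s : R^o) :
  (fun y : V => (y, s) : V * R^o) @ x --> ((x, s) : V * R^o).
Proof.
have a : id @ x --> x by exact: cvg_id.
have b : (fun _ : V => s) @ x --> s by exact: cvg_cst.
exact: (cvg_pair a b).
Qed.

Lemma derive_at_time n (F : V * R^o -> 'rV[R]_n) x v (s : R^o) :
  differentiable F (x, s) ->
  differentiable (fun y => F (y, s)) x /\
  'D_v (fun y => F (y, s)) x = 'D_((v, 0) : V * R^o) F (x, s).
Proof.
move=> dF; pose c (y : V) : V * R^o := (y, s).
have did : differentiable (id : V -> V) x by [].
have dc : differentiable c x.
  by apply: differentiable_pair; [exact: did|exact: differentiable_cst].
split; first exact: (differentiable_comp dc dF).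
rewrite -[LHS]/('D_v (F \o c) x) (derive_comp v dc dF); congr ('D__ F _).
rewrite deriveE// (diff_pair did (differentiable_cst _ _)).
by rewrite diff_val diff_cst.
Qed.

(** The speed is bounded near [(x0, 0)] by continuity; the mean value theorem is
    applied, coordinate by coordinate, on the time segments joining [(x, 0)] to
    [(x, s)]. *)
Lemma near_lipschitz n (F : V * R^o -> 'rV[R]_n) (U : set (V * R^o)) x0 :
  open U -> U (x0, 0) -> (forall z, U z -> differentiable F z) ->
  {for (x0, 0), continuous ('D_((0, 1) : V * R^o) F)} ->
  exists C : R, \forall z \near ((x0, 0) : V * R^o), forall j,
    `|F z 0 j - F (z.1, 0) 0 j| <= C * `|z.2|.
Proof.
move=> oU Ux0 dF cD.
pose D := 'D_((0, 1) : V * R^o) F.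
exists (`|D (x0, 0)| + 1).
have nU : \forall z \near ((x0, 0) : V * R^o), U z by exact: open_nbhs_nbhs.
have nD : \forall z \near ((x0, 0) : V * R^o), `|D z| <= `|D (x0, 0)| + 1.
  have /cvgrPdist_le/(_ 1 ltr01) := cD; apply: filterS => z Dz.
  have {}Dz : `|D (x0, 0) - D z| <= 1 by exact: Dz.
  rewrite -lerBlDl; apply: le_trans Dz.
  by rewrite (distrC (D (x0, 0)) (D z)); exact: lerB_dist.
have [r /= r0 rUD] := (nbhs_ballP _ _).1 (filterI nU nD).
apply/(nbhs_ballP _ _).2; exists r => //= -[x s] [/= bx bs] j.
(* Rescaling time to [0, 1] treats both signs of [s] at once. *)
pose c (t : R) : V * R^o := (x, t * s).
have inball (t : R) : 0 <= t <= 1 -> ball ((x0, 0) : V * R^o) r (c t).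
  move=> /andP[t0 t1]; split => //=; move: bs; rewrite /ball/= !sub0r !normrN.
  by apply: le_lt_trans; rewrite normrM ger0_norm// ler_piMl.
pose g (t : R) : R := F (c t) 0 j.
have Dg (t : R) : 0 <= t <= 1 -> is_derive t 1 g (s * D (c t) 0 j).
  move=> /inball/rUD[/= Uct _].
  have dFc := dF _ Uct.
  have dm : is_derive t 1 (fun t : R => t * s) s.
    by apply: is_derive_eq; rewrite scaler0 add0r; exact: mulr1.
  have dm' : differentiable (fun t : R => t * s : R^o) t.
    by apply/derivable1_diffP; have [] := dm.
  have dc : differentiable c t.
    by apply: differentiable_pair => //; exact: differentiable_cst.
  have dFct := differentiable_comp dc dFc.
  apply: DeriveDef.
    by apply: diff_derivable; exact: (differentiable_entry j dFct).
  rewrite -[LHS]/('D_1 (fun t => (F \o c) t 0 j) t) -derive_entry//.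
  rewrite (derive_comp (1 : R) dc dFc).
  have -> : 'D_1 c t = s *: ((0, 1) : V * R^o).
    rewrite deriveE// (diff_pair (differentiable_cst _ _) dm').
    rewrite diff_cst -deriveE//.
    have [_ ->] := dm.
    by congr pair; [rewrite scaler0|exact/esym/mulr1].
  by rewrite deriveE// linearZ -deriveE// mxE.
have cg : {within `[0, 1], continuous g}.
  apply: derivable_within_continuous => t; rewrite in_itv/= => t01.
  by have [] := Dg _ t01.
have [|||t] := @MVT_segment R g (fun t => s * D (c t) 0 j) 0 1.
- by rewrite ler01.
- by move=> t; rewrite in_itv/= => /andP[t0 t1]; apply: Dg; rewrite !ltW.
- exact: cg.
rewrite in_itv/= => t01; rewrite subr0 mulr1 /g /c mul1r mul0r => ->.
rewrite normrM mulrC ler_wpM2r//.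
have /inball/rUD[/= _] := t01.
exact/le_trans/entry_le_norm.
Qed.

End pairs.

End time_families.

(** * The slices *)

Section slices.
Context {R : realType}.
Local Notation rV3 := 'rV[R]_3.
Local Notation rV4 := 'rV[R]_(3 + 1).
Local Notation "'d_ j f" := ('D_(delta_mx 0 j) f)
  (at level 10, j at level 8, f at level 9).

(** The index of the interval coordinate of S^2 x (-1,1). *)
Definition tcoord : 'I_(3 + 1) := rshift 3 (0 : 'I_1).

Definition slice (t : R) (x : rV3) : rV4 := row_mx x (const_mx t).

(** The orthogonal projection onto the tangent plane of the sphere at [x]. *)
Definition tproj (x : rV3) (i j : 'I_3) : R := (i == j)%:R - x 0 i * x 0 j.

Lemma sum4 (V : nmodType) (F : 'I_(3 + 1) -> V) :
  \sum_k F k = \sum_(i < 3) F (lshift 1 i) + F tcoord.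
Proof. by rewrite big_split_ord/= big_ord1. Qed.

Lemma ord4P (P : 'I_(3 + 1) -> Prop) :
  (forall i, P (lshift 1 i)) -> P tcoord -> forall k, P k.
Proof.
move=> Pl Pt k; rewrite -(splitK k); case: (fintype.split k) => i /=; first exact: Pl.
by rewrite ord1; exact: Pt.
Qed.

Lemma tprojC (x : rV3) i j : tproj x i j = tproj x j i.
Proof. by rewrite /tproj eq_sym mulrC. Qed.

Lemma S2_entry_le1 (x : rV3) i : S2 x -> `|x 0 i| <= 1.
Proof.
move=> /S2_dot Sx; rewrite -sqrtr_sqr -[leRHS]sqrtr1 ler_sqrt ?ltr01//.
by rewrite -Sx (bigD1 i)//= lerDl; apply: sumr_ge0 => j _; exact: sqr_ge0.
Qed.

Lemma tproj_le2 (x : rV3) i j : S2 x -> `|tproj x i j| <= 2.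
Proof.
move=> Sx; rewrite (le_trans (ler_normB _ _))// (_ : 2 = 1 + 1)//.
apply: lerD; first by rewrite normr_nat lern1 leq_b1.
by rewrite normrM mulr_ile1// S2_entry_le1.
Qed.

Lemma bilin_scalar n (c : R) (v : 'rV[R]_n) :
  bilin c%:M v v = c * \sum_k v 0 k ^+ 2.
Proof.
rewrite /bilin mul_mx_scalar -scalemxAl mxE mxE; congr (_ * _).
by apply: eq_bigr => k _; rewrite mxE expr2.
Qed.

Lemma conformal_metricE (psi : R -> R) (p : rV4) :
  conformal_metric psi p = (psi (p 0 tcoord))%:M.
Proof. by rewrite /conformal_metric mxE. Qed.

Lemma sliceE (t : R) x : (forall i, slice t x 0 (lshift 1 i) = x 0 i) /\
  slice t x 0 tcoord = t.
Proof.
by split=> [i|]; rewrite /slice (row_mxEl, row_mxEr)// mxE.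
Qed.

Lemma derive_slice_map (t : R) x v :
  differentiable (slice t) x /\ 'D_v (slice t) x = row_mx v 0.
Proof.
have dE k : differentiable (fun y => slice t y 0 k) x.
  elim/ord4P: k => [i|].
    by under eq_fun do rewrite (sliceE t _).1; exact: differentiable_coord.
  by under eq_fun do rewrite (sliceE t _).2; exact: differentiable_cst.
have ds : differentiable (slice t) x by apply: differentiable_row.
split=> //; apply/rowP => k; rewrite derive_entry//.
elim/ord4P: k => [i|].
  under eq_fun do rewrite (sliceE t _).1.
  by rewrite row_mxEl -(@derive_entry _ _ _ id) ?derive_id.
under eq_fun do rewrite (sliceE t _).2.
by rewrite row_mxEr mxE derive_cst.
Qed.

Lemma dot_delta (x : rV3) i : \sum_j x 0 j * (delta_mx 0 i : rV3) 0 j = x 0 i.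
Proof.
rewrite (bigD1 i)//= mxE !eqxx mulr1 big1 ?addr0// => j ji.
by rewrite mxE eqxx (negPf ji) mulr0.
Qed.

Lemma tprojE (x : rV3) i j : (delta_mx 0 i - x 0 i *: x : rV3) 0 j = tproj x i j.
Proof. by rewrite !mxE eqxx/= eq_sym. Qed.

Lemma derive_S2_ext_slice (t : R) (u : rV3 -> rV4) x i : S2 x ->
  (forall y, S2 y -> u y = slice t y) ->
  'd_i (S2_ext u) x = row_mx (\row_j tproj x i j) 0.
Proof.
move=> Sx uE; have [ds _] := derive_slice_map t x 0.
have nu : \forall y \near x, S2 y -> slice t y = u y.
  by apply: (@filterE _ (nbhs x)) => y Sy; rewrite uE.
have [_ ->] := derive_S2_ext (delta_mx 0 i) Sx nu ds.
have [_ ->] := derive_slice_map t x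
   (delta_mx 0 i - (\sum_i0 x 0 i0 * (delta_mx 0 i : rV3) 0 i0) *: x).
by congr row_mx; apply/rowP => j; rewrite dot_delta tprojE mxE.
Qed.

End slices.

(** * Expansion of the energy density around a slice *)

Section density.
Context {R : realType}.
Local Notation rV3 := 'rV[R]_3.
Implicit Types (x y : rV3) (a : 'I_3 -> 'rV[R]_(3 + 1)).

(** The differential of the inclusion of a slice, composed with the projection
    onto the tangent plane. *)
Definition slice_diff x (i : 'I_3) : 'rV[R]_(3 + 1) :=
  row_mx (\row_j tproj x i j) 0.

Lemma slice_diffE x i : (forall j, slice_diff x i 0 (lshift 1 j) = tproj x i j)
  /\ slice_diff x i 0 tcoord = 0.
Proof. by split=> [j|]; rewrite /slice_diff (row_mxEl, row_mxEr)// mxE. Qed.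

Lemma sum_tproj_sqr x : S2 x -> \sum_i \sum_j tproj x i j ^+ 2 = 2.
Proof.
move=> /S2_dot; rewrite !sum3 /tproj/= => Sx.
have E : x 0 2 ^+ 2 = 1 - x 0 0 ^+ 2 - x 0 1 ^+ 2 by rewrite -Sx; ring.
by ring: E.
Qed.

(** For [y] the value at [x] of a map into the sphere and [a i] the derivatives
    of the radial extension, this is the integrand of the divergence theorem. *)
Definition linear_part x y a : R :=
  \sum_i \sum_j tproj x i j * a i 0 (lshift 1 j) - 2 * \sum_i x 0 i * y 0 i.

(** [p0] and [p] stand for the conformal factor on the slice and at the image
    point. *)
Definition remainder (p0 p : R) x y a : R :=
  (p - p0) * (\sum_i \sum_k a i 0 k ^+ 2) +
  p0 * (\sum_i \sum_k (a i - slice_diff x i) 0 k ^+ 2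
        - 2 * \sum_i (y - x) 0 i ^+ 2).

(** The squares of the [a i] are expanded around [slice_diff x i], whose squares
    add up to 2. The pairing of [slice_diff] with [a] is the tangential
    divergence, and the identity [`|y - x|^2 = 2 - 2 <x, y>] between unit vectors
    trades the zeroth order term for the one that makes [linear_part] integrate
    to zero. *)
Lemma density_expansion (p0 p : R) x y a : S2 x -> S2 y ->
  p * (\sum_i \sum_k a i 0 k ^+ 2) =
  2 * p0 + 2 * p0 * linear_part x y a + remainder p0 p x y a.
Proof.
move=> Sx Sy.
have sq : \sum_i \sum_k (a i - slice_diff x i) 0 k ^+ 2 =
  \sum_i \sum_k a i 0 k ^+ 2 - 2 * \sum_i \sum_j tproj x i j * a i 0 (lshift 1 j)
  + \sum_i \sum_j tproj x i j ^+ 2.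
  rewrite mulr_sumr -sumrB -big_split/=.
  apply: eq_bigr => i _; have [dl dt] := slice_diffE x i.
  have entry k : (a i - slice_diff x i) 0 k = a i 0 k - slice_diff x i 0 k.
    by rewrite !mxE.
  by rewrite !sum4 !sum3 !entry !dl dt; ring.
have dist : \sum_i (y - x) 0 i ^+ 2 =
    \sum_i x 0 i ^+ 2 + \sum_i y 0 i ^+ 2 - 2 * \sum_i x 0 i * y 0 i.
  by rewrite !sum3 !mxE; ring.
rewrite /remainder /linear_part sq dist (sum_tproj_sqr Sx) ((S2_dot x).1 Sx) ((S2_dot y).1 Sy).
by ring.
Qed.

Lemma sum_const n (F : 'I_n -> R) (c : R) :
  (forall i, F i <= c) -> \sum_(i < n) F i <= c *+ n.
Proof.
move=> Fc; rewrite -[n in leRHS]card_ord -sumr_const.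
by apply: ler_sum => i _; exact: Fc.
Qed.

(** There are 12 entries [a i 0 k], each at most [2 + K]; the two quadratic terms
    count [12 + 2 * 3 = 18] squares. *)
Lemma remainder_bound (p0 p eta K s : R) x y a : S2 x -> 0 <= eta -> 0 <= K ->
  `|s| <= 1 -> (forall i k, `|(a i - slice_diff x i) 0 k| <= K * `|s|) ->
  (forall i, `|(y - x) 0 i| <= K * `|s|) -> `|p - p0| <= eta * (K * `|s|) ->
  `|remainder p0 p x y a| <=
    (eta * K * (12 * (2 + K) ^+ 2) + `|p0| * (18 * K ^+ 2 * `|s|)) * `|s|.
Proof.
move=> Sx eta0 K0 s1 ab yx pp.
have Ks0 : 0 <= K * `|s| by rewrite mulr_ge0.
have sqle (u v : R) : `|u| <= v -> u ^+ 2 <= v ^+ 2.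
  by move=> uv; rewrite -real_normK ?num_real// lerXn2r ?nnegrE// (le_trans _ uv).
have b2 i k : `|slice_diff x i 0 k| <= 2.
  have [dl dt] := slice_diffE x i.
  by elim/ord4P: k => [j|]; rewrite ?dl ?dt ?normr0// tproj_le2.
have A0 : 0 <= \sum_i \sum_k a i 0 k ^+ 2.
  by apply: sumr_ge0 => i _; apply: sumr_ge0 => k _; exact: sqr_ge0.
have A : \sum_i \sum_k a i 0 k ^+ 2 <= 12 * (2 + K) ^+ 2.
  rewrite (_ : 12 * _ = (2 + K) ^+ 2 *+ 4 *+ 3); last by ring.
  apply: sum_const => i; apply: sum_const => k; apply: sqle.
  have -> : a i 0 k = slice_diff x i 0 k + (a i - slice_diff x i) 0 k.
    by rewrite !mxE; ring.
  rewrite (le_trans (ler_normD _ _))// lerD//.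
  by rewrite (le_trans (ab i k))// ler_piMr.
have D0 : 0 <= \sum_i \sum_k (a i - slice_diff x i) 0 k ^+ 2.
  by apply: sumr_ge0 => i _; apply: sumr_ge0 => k _; exact: sqr_ge0.
have D : \sum_i \sum_k (a i - slice_diff x i) 0 k ^+ 2 <=
    12 * (K * `|s|) ^+ 2.
  rewrite (_ : 12 * _ = (K * `|s|) ^+ 2 *+ 4 *+ 3); last by ring.
  by apply: sum_const => i; apply: sum_const => k; exact: sqle.
have Y0 : 0 <= \sum_i (y - x) 0 i ^+ 2.
  by apply: sumr_ge0 => i _; exact: sqr_ge0.
have Y : \sum_i (y - x) 0 i ^+ 2 <= 3 * (K * `|s|) ^+ 2.
  rewrite (_ : 3 * _ = (K * `|s|) ^+ 2 *+ 3); last by ring.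
  by apply: sum_const => i; exact: sqle.
rewrite /remainder (le_trans (ler_normD _ _))// [leRHS]mulrDl; apply: lerD.
  rewrite normrM (ger0_norm A0).
  rewrite (_ : _ * `|s| = eta * (K * `|s|) * (12 * (2 + K) ^+ 2)); last by ring.
  by apply: ler_pM.
rewrite normrM -[leRHS]mulrA ler_wpM2l// (_ : _ * `|s| = 18 * (K * `|s|) ^+ 2); last by ring.
rewrite ler_norml; apply/andP; split; lra.
Qed.

End density.

(** * First variation of the energy at a slice *)

Section first_variation.
Context {R : realType}.
Local Notation rV3 := 'rV[R]_3.
Local Notation rV4 := 'rV[R]_(3 + 1).
Local Notation "'d_ j f" := ('D_(delta_mx 0 j) f)
  (at level 10, j at level 8, f at level 9).
Local Notation dx j := ((delta_mx 0 j, 0) : rV3 * R^o).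

Lemma compact_S2 : compact (@S2 R).
Proof.
apply: bounded_closed_compact.
  exists 1; split; first exact: num_real.
  move=> M M1 x Sx; rewrite /= [leLHS]/Num.Def.normr/= mx_normrE.
  apply: bigmax_le => [|[i j] _ /=]; first by rewrite (le_trans ler01)// ltW.
  by rewrite (ord1 i) (le_trans (S2_entry_le1 j Sx))// ltW.
rewrite (_ : @S2 R = [set x | (\sum_i x 0 i ^+ 2 : R) = 1]); last first.
  by apply/seteqP; split => x /S2_dot.
apply: (@closed_comp _ _ (fun x : rV3 => \sum_i x 0 i ^+ 2 : R) [set 1]).
  move=> x _; apply: (cvg_bigsum (F := nbhs x)) => i; rewrite expr2.
  under eq_fun do rewrite expr2.
  have ci := @coord_continuous R 1 3 0 i x.
  exact: (cvgM ci ci).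
exact: closed_eq.
Qed.

(** The local extensions of a map on the sphere change from point to point, so
    continuity is checked with a different [H] at each point. *)
Lemma S2_continuous_local (f : rV3 -> R) :
  (forall x, S2 x -> exists H : rV3 -> R,
     H @ x --> H x /\ \forall y \near x, S2 y -> H y = f y) ->
  S2_continuous f.
Proof.
move=> loc p; have Sp := spherical_S2 p.1 p.2.
have [H [cH Hf]] := loc _ Sp.
have cs := @continuous_spherical R p.
have cHs : (fun q : R * R => H (spherical q.1 q.2)) @ p -->
    f (spherical p.1 p.2).
  rewrite -(nbhs_singleton Hf Sp).
  exact: (cvg_comp _ _ cs cH).
apply: cvg_trans cHs; apply: near_eq_cvg.
near=> q.
have : S2 (spherical q.1 q.2) by exact: spherical_S2.
by near: q; exact: cs Hf.
Unshelve. all: by end_near. Qed.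

Variables (t0 e : R) (w : rV3 * R^o -> rV4).
Hypothesis e0 : 0 < e.
Hypothesis wvar : Defs.variation (@S2xI R) (slice t0) e w.

Let W (s : R) := S2_ext (fun x => w (x, s)).

(** A local extension of the variation with two derivatives: one enters the
    energy density, the other controls its change in time. *)
Let local_ext (x0 : rV3) (s0 : R) : S2 x0 -> - e < s0 < e ->
  exists (U : set (rV3 * R^o)) (F : rV3 * R^o -> rV4),
  [/\ open U, U (x0, s0), forall z, U z -> differentiable F z,
      forall v z, U z -> differentiable ('D_v F) z &
      forall v v' z, U z -> {for z, continuous ('D_v' ('D_v F))}] /\
  (forall x s, S2 x -> - e < s < e -> U (x, s) -> F (x, s) = w (x, s)).
Proof.
move=> Sx se; have [sw _ _] := wvar.
have [|U [F [oU Ux CF Fw]]] := sw (x0, s0); first by split.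
exists U, F; have [dF /(_ _) CF1] := CF 2%N.
split; last by move=> x s Sx' se' Uxs; exact: Fw.
split; [exact: oU|exact: Ux|exact: dF| |].
- by move=> v z Uz; have [dDF _] := CF1 v; exact: dDF.
- by move=> v v' z Uz; have [_ /(_ v')] := CF1 v; apply.
Qed.

(** Along the sphere, the derivatives of the radial extension are combinations of
    those of any local extension, with coefficients independent of time. *)
Let derive_W (U : set (rV3 * R^o)) (F : rV3 * R^o -> rV4) x (s : R) :
  open U -> (forall z, U z -> differentiable F z) ->
  (forall x s, S2 x -> - e < s < e -> U (x, s) -> F (x, s) = w (x, s)) ->
  S2 x -> - e < s < e -> U (x, s) ->
  differentiable (W s) x /\
  forall i, 'd_i (W s) x = \sum_j tproj x i j *: 'D_(dx j) F (x, s).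
Proof.
move=> oU dF Fw Sx se Uxs.
have nFw : \forall y \near x, S2 y -> F (y, s) = w (y, s).
  have nU : \forall y \near x, U (y, s).
    exact: cvg_at_time (open_nbhs_nbhs (conj oU Uxs)).
  by apply: (filterS _ nU) => y Uys Sy; exact: Fw.
have [dFs _] := derive_at_time 0 (dF _ Uxs).
split; first by have [] := derive_S2_ext 0 Sx nFw dFs.
move=> i; have [_ ->] := derive_S2_ext (delta_mx 0 i) Sx nFw dFs.
rewrite (derive_delta _ dFs); apply: eq_bigr => j _.
rewrite dot_delta tprojE.
by have [_ ->] := derive_at_time (delta_mx 0 j) (dF _ Uxs).
Qed.

Lemma variation_regular (s : R) : - e < s < e ->
  (forall x, S2 x -> differentiable (W s) x) /\
  (forall i k, S2_continuous (fun x : rV3 => 'd_i (W s) x 0 k)).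
Proof.
move=> se; split=> [x Sx|i k].
  have [U [F [[oU Ux dF _ _] Fw]]] := local_ext Sx se.
  by have [] := derive_W oU dF Fw Sx se Ux.
apply: S2_continuous_local => x0 Sx0.
have [U [F [[oU Ux dF dDF _] Fw]]] := local_ext Sx0 se.
exists (fun x => (\sum_j tproj x i j *: 'D_(dx j) F (x, s)) 0 k); split.
  have cy : (fun y : rV3 => (y, s) : rV3 * R^o) @ x0 --> ((x0, s) : rV3 * R^o).
    exact: cvg_at_time.
  apply: (@cvg_comp _ _ _ (fun x => \sum_j tproj x i j *: 'D_(dx j) F (x, s))
    (fun v : rV4 => v 0 k)); last exact: coord_continuous.
  apply: (cvg_bigsum (F := nbhs x0)) => j; apply: cvgZ.
    have c k := @coord_continuous R 1 3 0 k x0.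
    exact: (cvgB (cvg_cst _) (cvgM (c i) (c j))).
  have cD := differentiable_continuous (dDF (dx j) _ Ux).
  exact: (cvg_comp _ _ cy cD).
have nU : \forall y \near x0, U (y, s).
  exact: cvg_at_time (open_nbhs_nbhs (conj oU Ux)).
apply: (filterS _ nU) => x Uxs Sx; have [_ ->] := derive_W oU dF Fw Sx se Uxs.
by [].
Qed.

Lemma variation0 : forall y, S2 y -> w (y, 0) = slice t0 y.
Proof. by have [_ _ w0] := wvar. Qed.

Lemma variation_entry_continuous (s : R) k : - e < s < e ->
  S2_continuous (fun x : rV3 => w (x, s) 0 k).
Proof.
move=> se; have [dW _] := variation_regular se.
apply: (@eq_S2_continuous R (fun x : rV3 => W s x 0 k)).
  by move=> x Sx; rewrite /W /S2_ext -/(sphere_proj x) sphere_proj_id.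
apply: S2_continuous_near => x Sx.
by apply: differentiable_continuous; apply: differentiable_entry; exact: dW.
Qed.

Lemma variation_linear_part (s : R) : - e < s < e ->
  let L := fun x => linear_part x (lsubmx (w (x, s))) (fun i => 'd_i (W s) x) in
  S2_continuous L /\ S2_integral L = 0.
Proof.
move=> se L; have [dW cDW] := variation_regular se.
split.
  have -> : L = fun x => \sum_i \sum_j
      ((i == j)%:R - x 0 i * x 0 j) * 'd_i (W s) x 0 (lshift 1 j)
      + (-2) * \sum_i x 0 i * w (x, s) 0 (lshift 1 i).
    apply/funext => x; rewrite /L /linear_part mulNr.
    by congr (_ - 2 * _); apply: eq_bigr => i _; rewrite mxE.
  apply: S2_continuousD.
    apply: S2_continuous_sum => i; apply: S2_continuous_sum => j.
    apply: S2_continuousM; last exact: cDW.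
    apply: S2_continuousD; first exact: S2_continuous_cst.
    rewrite (_ : (fun x => _) = fun x : rV3 => (-1) * (x 0 i * x 0 j)).
      apply: S2_continuousM; first exact: S2_continuous_cst.
      by apply: S2_continuousM; exact: S2_continuous_entry.
    by apply/funext => x; rewrite mulN1r.
  apply: S2_continuousM; first exact: S2_continuous_cst.
  apply: S2_continuous_sum => i.
  apply: S2_continuousM; first exact: S2_continuous_entry.
  exact: variation_entry_continuous.
pose G (i : 'I_3) (y : rV3) := W s y 0 (lshift 1 i).
have dG i x : S2 x -> differentiable (G i) x.
  by move=> Sx; apply: differentiable_entry; exact: dW.
have DG i j x : S2 x -> 'd_j (W s) x 0 (lshift 1 i) = 'd_j (G i) x.
  by move=> Sx; rewrite derive_entry//; exact: dW.
rewrite -(sphere_divergence dG); last first.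
  by move=> i j; apply: (eq_S2_continuous _ (cDW j (lshift 1 i))) => x; exact: DG.
apply: eq_S2_integral => x Sx; rewrite /L /linear_part; congr (_ - 2 * _).
  rewrite exchange_big/=; apply: eq_bigr => i _; apply: eq_bigr => j _.
  by rewrite DG// tprojC.
apply: eq_bigr => i _; rewrite mxE /G /W /S2_ext -/(sphere_proj x).
by rewrite sphere_proj_id.
Qed.

Variable psi : R -> R.
Hypothesis cpsi : forall t, -1 < t < 1 -> {for t, continuous psi}.
Hypothesis dpsi : is_derive t0 1 psi 0.

Let rem (s : R) (x : rV3) := remainder (psi t0) (psi (w (x, s) 0 tcoord)) x
  (lsubmx (w (x, s))) (fun i => 'd_i (W s) x).

Let rem_continuous (s : R) : - e < s < e -> S2_continuous (rem s).
Proof.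
move=> se; have [dW cDW] := variation_regular se.
have cw k := @variation_entry_continuous s k se.
have sqr (f : rV3 -> R) : S2_continuous f -> S2_continuous (fun x : rV3 => f x ^+ 2).
  move=> cf; rewrite (_ : (fun x => _) = fun x => f x * f x).
    exact: S2_continuousM.
  by apply/funext => x; rewrite expr2.
have opp (f : rV3 -> R) : S2_continuous f -> S2_continuous (fun x : rV3 => - f x).
  by move=> cf p; apply: cvgN; exact: cf.
have cp : S2_continuous (fun x : rV3 => psi (w (x, s) 0 tcoord)).
  move=> p; apply: (@continuous_comp _ _ _
    (fun p : R * R => w (spherical p.1 p.2, s) 0 tcoord) psi); first exact: cw.
  apply: cpsi; have [_ wN _] := wvar.
  have [_] := wN (spherical p.1 p.2) s (spherical_S2 _ _) se.
  by rewrite mxE.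
have ct i k : S2_continuous (fun x : rV3 => slice_diff x i 0 k).
  elim/ord4P: k => [j|].
    apply: (@eq_S2_continuous R (fun x : rV3 => (i == j)%:R - x 0 i * x 0 j)).
      by move=> x _; have [-> _] := slice_diffE x i.
    apply: S2_continuousD; first exact: S2_continuous_cst.
    apply: (opp (fun x => x 0 i * x 0 j)).
    by apply: S2_continuousM; exact: S2_continuous_entry.
  apply: (@eq_S2_continuous R (fun=> 0)); last exact: S2_continuous_cst.
  by move=> x _; have [_ ->] := slice_diffE x i.
apply: S2_continuousD; apply: S2_continuousM.
- by apply: S2_continuousD; [exact: cp|exact: S2_continuous_cst].
- apply: S2_continuous_sum => i; apply: S2_continuous_sum => k.
  by apply: sqr; exact: cDW.
- exact: S2_continuous_cst.
- apply: S2_continuousD.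
    apply: S2_continuous_sum => i; apply: S2_continuous_sum => k; apply: sqr.
    apply: (@eq_S2_continuous R (fun x : rV3 => 'd_i (W s) x 0 k - slice_diff x i 0 k)).
      by move=> x _; rewrite !mxE.
    apply: S2_continuousD; first exact: cDW.
    by apply: (opp (fun x => slice_diff x i 0 k)); exact: ct.
  apply: (opp (fun x => 2 * \sum_i (lsubmx (w (x, s)) - x) 0 i ^+ 2)).
  apply: S2_continuousM; first exact: S2_continuous_cst.
  apply: S2_continuous_sum => i; apply: sqr.
  apply: (@eq_S2_continuous R (fun x : rV3 => w (x, s) 0 (lshift 1 i) - x 0 i)).
    by move=> x _; rewrite !mxE.
  apply: S2_continuousD; first exact: cw.
  by apply: (opp (fun x => x 0 i)); exact: S2_continuous_entry.
Qed.

Let energy_expansion (s : R) : - e < s < e ->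
  energy (conformal_metric psi) (fun x => w (x, s)) =
  4 * pi * psi t0 + 2^-1 * S2_integral (rem s).
Proof.
move=> se; have [cL L0] := variation_linear_part se.
set L := fun x => linear_part _ _ _ in cL L0.
have cr := rem_continuous se.
have cc c := @S2_continuous_cst R c.
have -> : energy (conformal_metric psi) (fun x => w (x, s)) =
  2^-1 * S2_integral (fun x => (2 * psi t0 + 2 * psi t0 * L x) + rem s x).
  congr (_ * _); apply: eq_S2_integral => x Sx; rewrite /grad_sq.
  have [_ wN _] := wvar; have [Sw _] := wN x s Sx se.
  rewrite -(density_expansion _ _ _ Sx Sw) mulr_sumr.
  by apply: eq_bigr => i _; rewrite conformal_metricE bilin_scalar.
rewrite S2_integralD//; last first.
  by apply: S2_continuousD; [exact: cc|apply: S2_continuousM].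
rewrite S2_integralD ?S2_integralZ ?L0//; last exact: S2_continuousM.
rewrite mulr0 addr0 S2_integral_cst mulrDr; congr (_ + _).
by field.
Qed.

(** The values and the derivatives of the variation move by at most
    [K * `|s|] near [x0]; [eta] and the bound on the time are chosen so that each
    of the two terms of [remainder_bound] is at most half of [eps]. *)
Let rem_local (x0 : rV3) (eps : R) : S2 x0 -> 0 < eps ->
  \forall z \near ((x0, 0) : rV3 * R^o), S2 z.1 ->
    `|rem z.2 z.1| <= eps * `|z.2|.
Proof.
move=> Sx0 eps0; have e00 : - e < 0 < e by rewrite oppr_lt0 e0.
have [U [F [[oU Ux dF dDF cDDF] Fw]]] := local_ext Sx0 e00.
have near_time (d : R) : 0 < d ->
    \forall z \near ((x0, 0) : rV3 * R^o), `|z.2| < d.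
  move=> d0; have c2 : (fun z : rV3 * R^o => z.2) @ (x0, 0 : R^o) --> (0 : R^o).
    exact: cvg_snd.
  by have /cvgr0_norm_lt/(_ _ d0) := c2.
have nU : \forall z \near ((x0, 0) : rV3 * R^o), U z by exact: open_nbhs_nbhs.
have [C HC] := near_lipschitz oU Ux dF (differentiable_continuous (dDF _ _ Ux)).
have /choice[c Hc] : forall j : 'I_3, exists c : R,
    \forall z \near ((x0, 0) : rV3 * R^o), forall k,
    `|'D_(dx j) F z 0 k - 'D_(dx j) F (z.1, 0) 0 k| <= c * `|z.2|.
  move=> j; apply: (near_lipschitz oU Ux (dDF (dx j))).
  exact: cDDF Ux.
have {}Hc : \forall z \near ((x0, 0) : rV3 * R^o), forall j k,
    `|'D_(dx j) F z 0 k - 'D_(dx j) F (z.1, 0) 0 k| <= c j * `|z.2|.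
  exact: (filter_forall _ Hc).
pose K := `|C| + \sum_j 2 * `|c j|.
have K0 : 0 <= K.
  by rewrite addr_ge0// sumr_ge0// => j _; rewrite mulr_ge0.
pose A := K * (12 * (2 + K) ^+ 2).
have A0 : 0 <= A by rewrite mulr_ge0// mulr_ge0// exprn_ge0// addr_ge0.
pose eta := eps / (2 * (A + 1)).
have eta0 : 0 < eta by rewrite divr_gt0// mulr_gt0// ltr_wpDl.
pose B := `|psi t0| * (18 * K ^+ 2).
have B0 : 0 <= B by rewrite mulr_ge0// mulr_ge0// exprn_ge0.
have [r r0 Hr] : exists2 r : R, 0 < r & forall t, `|t - t0| < r ->
    `|psi t - psi t0| <= eta * `|t - t0|.
  have lim0 : h^-1 *: ((psi \o shift t0) (h *: 1) - psi t0) @[h --> 0^'] --> 0.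
    by have [d1 d2] := dpsi; rewrite -[X in _ --> X]d2; exact: d1.
  have /cvgr0_norm_le/(_ _ eta0)[r /= r0 Hr] := lim0.
  exists r => // t tr; have [->|tt0] := eqVneq t t0.
    by rewrite !subrr normr0 mulr0.
  have h0 : t - t0 != 0 by rewrite subr_eq0.
  have := Hr (t - t0) _ h0; rewrite /ball_/= sub0r normrN => /(_ tr).
  rewrite [_ *: 1]mulr1 subrK normrM normfV ler_pdivrMl ?normr_gt0//.
  by rewrite mulrC.
have r1 : 0 < r / (K + 1) by rewrite divr_gt0// ltr_wpDl.
have B1 : 0 < eps / (2 * (B + 1)) by rewrite divr_gt0// mulr_gt0// ltr_wpDl.
near=> z => Sz.
have ze : - e < z.2 < e by rewrite -ltr_norml; near: z; exact: near_time.
have Uz : U z by near: z.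
have Uz0 : U (z.1, 0).
  near: z.
  have c1 : (fun z : rV3 * R^o => z.1) @ (x0, 0 : R^o) --> x0 by exact: cvg_fst.
  have := cvg_comp _ _ c1 (@cvg_at_time _ _ x0 0).
  by move=> /(_ U); apply; exact: open_nbhs_nbhs.
have zE : z = (z.1, z.2) by case: (z).
have Uzz : U (z.1, z.2) by rewrite -zE.
have wdiff k : `|w z 0 k - slice t0 z.1 0 k| <= K * `|z.2|.
  rewrite -variation0// -(Fw _ _ Sz e00 Uz0) {1}zE -Fw -?zE//.
  apply: (@le_trans _ _ (C * `|z.2|)); first by move: k; near: z.
  apply: ler_wpM2r => //; apply: le_trans (ler_norm _) _; rewrite lerDl.
  by apply: sumr_ge0 => j _; exact: mulr_ge0.
have W0 i : 'd_i (W 0) z.1 = slice_diff z.1 i.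
  by apply: derive_S2_ext_slice => // y; exact: variation0.
have [tl tt] := sliceE t0 z.1.
apply: le_trans (@remainder_bound _ (psi t0) _ eta K z.2 z.1 _ _ Sz (ltW eta0)
  K0 _ _ _ _) _.
- by apply/ltW; near: z; exact: near_time.
- move=> i k; rewrite -W0.
  have [_ ->] := derive_W oU dF Fw Sz ze Uzz.
  have [_ ->] := derive_W oU dF Fw Sz e00 Uz0.
  rewrite -sumrB summxE (le_trans (ler_norm_sum _ _ _))//.
  apply: (@le_trans _ _ ((\sum_j 2 * `|c j|) * `|z.2|)); last first.
    by rewrite ler_wpM2r// lerDr.
  rewrite mulr_suml; apply: ler_sum => j _.
  rewrite -scalerBr mxE normrM -mulrA ler_pM ?tproj_le2//.
  apply: (@le_trans _ _ (c j * `|z.2|)); last first.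
    by rewrite ler_wpM2r// ler_norm.
  rewrite !mxE -zE; move: j k; near: z.
  exact: Hc.
- by move=> i; have := wdiff (lshift 1 i); rewrite tl !mxE -zE.
- apply: le_trans (Hr _ _) _.
    apply: (@le_lt_trans _ _ (K * `|z.2|)).
      by have := wdiff tcoord; rewrite tt -zE.
    apply: (@le_lt_trans _ _ ((K + 1) * `|z.2|)).
      by rewrite ler_wpM2r// lerDl.
    rewrite mulrC -ltr_pdivlMr ?ltr_wpDl//.
    by near: z; exact: near_time.
  rewrite ler_pM2l//.
  by have := wdiff tcoord; rewrite tt -zE.
- rewrite ler_wpM2r// (splitr eps); apply: lerD.
    have -> : eps / 2 = eta * (A + 1).
      by rewrite /eta; field; rewrite gt_eqF// ltr_wpDl.
    by rewrite -mulrA ler_pM2l// lerDl.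
  rewrite (_ : _ * _ = B * `|z.2|); last by rewrite /B; ring.
  apply: (@le_trans _ _ ((B + 1) * `|z.2|)).
    by rewrite ler_wpM2r// lerDl.
  rewrite mulrC -ler_pdivlMr ?ltr_wpDl//.
  rewrite (_ : eps / 2 / (B + 1) = eps / (2 * (B + 1))); last first.
    by rewrite invfM mulrA.
  by apply/ltW; near: z; exact: near_time.
Unshelve. all: by end_near. Qed.

Let rem_uniform (eps : R) : 0 < eps ->
  \forall s \near (0 : R), forall x, S2 x -> `|rem s x| <= eps * `|s|.
Proof.
move=> eps0.
have /compact_near_coveringP/near_covering_withinP ncov := compact_S2.
apply: (ncov R (nbhs (0 : R)) (fun s x => `|rem s x| <= eps * `|s|)) => x Sx.
exact: (rem_local Sx eps0).
Qed.

(** The energy is [4 * pi * psi t0] up to half of the integral of the remainder,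
    which is [o(s)]. *)
Theorem slice_stationary :
  is_derive (0 : R^o) 1 (fun s : R^o =>
    energy (conformal_metric psi) (fun x => w (x, s)) : R^o) 0.
Proof.
pose E (s : R) := energy (conformal_metric psi) (fun x => w (x, s)).
have Ebound (eps : R) : 0 < eps ->
    \forall s \near (0 : R), `|E s - 4 * pi * psi t0| <= eps * `|s|.
  move=> eps0; have k0 : 0 < eps / (2 * pi) by rewrite divr_gt0// mulr_gt0 ?pi_gt0.
  near=> s.
  have se : - e < s < e by rewrite -ltr_norml; near: s; exact: (@nbhs0_lt _ R^o _ e0).
  rewrite /E (energy_expansion se) addrAC subrr add0r normrM ger0_norm ?invr_ge0//.
  rewrite mulrC ler_pdivrMr//.
  apply: (@le_trans _ _ (4 * pi * (eps / (2 * pi) * `|s|))).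
    apply: S2_integral_bound; first exact: rem_continuous.
    by near: s; exact: rem_uniform.
  rewrite le_eqVlt; apply/orP; left; apply/eqP.
  by have := pi_gt0 R; move: (pi : R) => p p0; field; rewrite gt_eqF.
have E0 : E 0 = 4 * pi * psi t0.
  apply/eqP; rewrite -subr_eq0 -normr_le0.
  by have := nbhs_singleton (Ebound 1 ltr01); rewrite /= normr0 mulr0; apply.
have lim0 : h^-1 *: ((E \o shift 0) (h *: 1) - E 0) @[h --> (0 : R)^'] --> (0 : R).
  apply/cvgr0Pnorm_le => eps eps0; have := Ebound _ eps0; rewrite -E0 => H.
  have {}H : \forall s \near (0 : R)^', `|E s - E 0| <= eps * `|s|.
    exact: nbhs_dnbhs H.
  near=> h; have h0 : h != 0 by near: h; exact: nbhs_dnbhs_neq.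
  rewrite /= [_ *: 1]mulr1 addr0 normrM normfV ler_pdivrMl ?normr_gt0//.
  by rewrite mulrC; near: h.
apply: DeriveDef; first by apply/cvg_ex; exists 0; exact: lim0.
by apply/cvg_lim => //; exact: lim0.
Unshelve. all: by end_near. Qed.

End first_variation.

(** * Smooth functions *)

Section Ck_closure.
Context {R : realType} {V : normedModType R}.
Implicit Types (W : normedModType R) (U : set V) (f g : V -> R).

Lemma open_near U (P : V -> Prop) x : open U -> U x -> (forall y, U y -> P y) ->
  \forall y \near x, P y.
Proof. by move=> oU Ux UP; apply: filterS (open_nbhs_nbhs (conj oU Ux)). Qed.

Lemma eq_Ck W k U (f g : V -> W) : open U ->
  (forall x, U x -> f x = g x) -> Ck k U f -> Ck k U g.
Proof.
move=> oU; elim: k f g => [|k IHk] f g fg /=.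
  move=> cf x Ux; rewrite /prop_for /continuous_at -(fg _ Ux).
  apply: cvg_trans (cf x Ux); apply: near_eq_cvg.
  by apply: (open_near oU Ux) => y; exact: fg.
move=> [df Df]; split=> [x Ux|v].
  by apply: near_eq_differentiable (df x Ux); exact: (open_near oU Ux).
apply: IHk (Df v) => x Ux; apply: near_eq_derive.
exact: (open_near oU Ux).
Qed.

Lemma CkW W k U (f : V -> W) : Ck k.+1 U f -> Ck k U f.
Proof.
elim: k f => [|k IHk] f [df Df]; first by move=> x /df /differentiable_continuous.
by split=> // v; exact: IHk.
Qed.

Lemma Ck_cst W k U (a : W) : Ck k U (fun=> a).
Proof.
elim: k a => [|k IHk] a /=; first by move=> x _; exact: cvg_cst.
split=> [x _|v]; first exact: differentiable_cst.
rewrite (_ : 'D_v _ = fun=> 0); first exact: IHk.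
by apply/funext => x; exact: derive_cst.
Qed.

Lemma CkD k U f g : open U -> Ck k U f -> Ck k U g ->
  Ck k U (fun x => f x + g x).
Proof.
move=> oU; elim: k f g => [|k IHk] f g.
  by move=> cf cg x Ux; apply: cvgD; [exact: cf|exact: cg].
move=> [df Df] [dg Dg]; split=> [x Ux|v].
  by apply: differentiableD; [exact: df|exact: dg].
apply: eq_Ck (IHk _ _ (Df v) (Dg v)) => // x Ux.
by rewrite -deriveD//; apply: diff_derivable; [exact: df|exact: dg].
Qed.

(** The derivative of a product contains the factors themselves, hence the use of
    [CkW] in the induction. *)
Lemma CkM k U f g : open U -> Ck k U f -> Ck k U g ->
  Ck k U (fun x => f x * g x).
Proof.
move=> oU; elim: k f g => [|k IHk] f g.
  by move=> cf cg x Ux; apply: cvgM; [exact: cf|exact: cg].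
move=> Cf Cg; have [df Df] := Cf; have [dg Dg] := Cg; split=> [x Ux|v].
  by apply: differentiableM; [exact: df|exact: dg].
apply: eq_Ck (CkD oU (IHk _ _ (Df v) (CkW Cg)) (IHk _ _ (CkW Cf) (Dg v))) => //.
move=> x Ux; apply/esym.
have Ff := derivableP (@diff_derivable _ _ _ f x v (df _ Ux)).
have Fg := derivableP (@diff_derivable _ _ _ g x v (dg _ Ux)).
by have [_ ->] := is_derive_mul Ff Fg.
Qed.

Lemma CkV k U f : open U -> (forall x, U x -> f x != 0) -> Ck k U f ->
  Ck k U (fun x => (f x)^-1).
Proof.
move=> oU f0; elim: k => [|k IHk] Cf.
  by move=> x Ux; apply: cvgV; [exact: f0|exact: Cf].
have [df Df] := Cf; split=> [x Ux|v].
  by apply: differentiableV; [exact: df|exact: f0].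
have Ci := IHk (CkW Cf).
apply: eq_Ck (CkM oU (Ck_cst k U (-1 : R)) (CkM oU (CkM oU Ci Ci) (Df v))) => //.
move=> x Ux; rewrite deriveV ?f0//; last exact/diff_derivable/df.
by rewrite mulN1r scaleNr -invfM -expr2.
Qed.

Lemma CkZ W k U f (a : W) : open U -> Ck k U f ->
  Ck k U (fun x => f x *: a).
Proof.
move=> oU; elim: k f => [|k IHk] f.
  by move=> cf x Ux; apply: cvgZ; [exact: cf|exact: cvg_cst].
move=> [df Df]; split=> [x Ux|v]; first exact/differentiableZl/df.
apply: eq_Ck (IHk _ (Df v)) => // x Ux.
rewrite [in RHS]deriveE; last exact/differentiableZl/df.
by rewrite diffZl ?deriveE//; exact: df.
Qed.

Lemma Ck_row n k U (f : V -> 'rV[R]_n) : open U ->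
  (forall j, Ck k U (fun x => f x 0 j : R)) -> Ck k U f.
Proof.
move=> oU; elim: k f => [|k IHk] f Cf.
  by move=> x Ux; apply: continuous_row => j; exact: Cf.
have df x : U x -> differentiable f x.
  by move=> Ux; apply: differentiable_row => j; have [dfj _] := Cf j; exact: dfj.
split=> [//|v]; apply: IHk => j; have [_ Dfj] := Cf j.
by apply: eq_Ck (Dfj v) => // x Ux; rewrite derive_entry//; exact: df.
Qed.

Lemma Ck_comp k U (U0 : set R^o) (g : V -> R) (F : R^o -> R^o) : open U ->
  (forall x, U x -> U0 (g x)) -> Ck k U g -> Ck k U0 F -> Ck k U (F \o g).
Proof.
move=> oU gU; elim: k F => [|k IHk] F.
  move=> cg cF x Ux; apply: (@continuous_comp _ _ _ g F); first exact: cg.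
  exact/cF/gU.
move=> Cg CF; have [dg Dg] := Cg; have [dF DF] := CF; split=> [x Ux|v].
  by apply: (@differentiable_comp _ _ _ _ g F); [exact: dg|exact/dF/gU].
apply: eq_Ck (CkM oU (Dg v) (IHk _ (CkW Cg) (DF 1))) => // x Ux.
rewrite (derive_comp v (dg _ Ux) (dF _ (gU _ Ux))) /=.
rewrite (deriveE ('D_v g x) (dF _ (gU _ Ux))).
rewrite (deriveE (1 : R^o) (dF _ (gU _ Ux))).
rewrite -[X in _ = 'd _ _ X]mulr1.
by rewrite -[X in _ = 'd _ _ X]/('D_v g x *: (1 : R^o)) linearZ.
Qed.

End Ck_closure.

Lemma Ck_coord (R : realType) n k (U : set 'rV[R]_n) j :
  Ck k U (fun x : 'rV[R]_n => x 0 j : R).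
Proof.
case: k => [|k]; first by move=> x _; exact: coord_continuous.
split=> [x _|v]; first exact: differentiable_coord.
rewrite (_ : 'D_v _ = fun=> v 0 j); first exact: Ck_cst.
apply/funext => x; rewrite -(@derive_entry _ _ _ id) ?derive_id//.
Qed.

(** * The manifold S^2 x (-1,1) *)

Section product_manifold.
Context {R : realType}.
Local Notation rV3 := 'rV[R]_3.
Local Notation rV4 := 'rV[R]_(3 + 1).

Lemma smooth_slice (A : set rV3) (t : R) : smooth_on A (slice t).
Proof.
move=> x _; exists setT, (slice t); split=> //; first exact: openT.
move=> k; apply: Ck_row => [|j]; first exact: openT.
elim/ord4P: j => [i|].
  apply: (@eq_Ck _ _ _ _ _ (fun x : rV3 => x 0 i)) (Ck_coord _ _ _).
    exact: openT.
  by move=> y _; rewrite (sliceE t y).1.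
apply: (@eq_Ck _ _ _ _ _ (fun=> t)) (Ck_cst _ _ _); first exact: openT.
by move=> y _; rewrite (sliceE t y).2.
Qed.

Lemma S2xIP (p : rV4) : S2xI p <->
  \sum_i p 0 (lshift 1 i) ^+ 2 = 1 /\ -1 < p 0 tcoord < 1.
Proof.
have E : \sum_i p 0 (lshift 1 i) ^+ 2 = \sum_i (lsubmx p : rV3) 0 i ^+ 2.
  by apply: eq_bigr => i _; rewrite mxE.
have T : p 0 tcoord = (rsubmx p : 'rV[R]_1) 0 0 by rewrite mxE.
rewrite E T; split=> -[h1 h2]; split => //; exact/S2_dot.
Qed.

Lemma slice_S2xI (t : R) (x : rV3) : -1 < t < 1 -> S2 x -> S2xI (slice t x).
Proof.
move=> t1 /S2_dot Sx; apply/S2xIP; have [sl ->] := sliceE t x; split => //.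
by under eq_bigr do rewrite sl.
Qed.

(** Stereographic projection from the pole [(0, 0, e)], with [e = 1] or
    [e = -1], times the identity of the interval. *)
Definition stereo (e : R) (y : rV4) : rV3 :=
  let q := (1 - e * y 0 (lshift 1 2))^-1 in
  \row_(j < 3) [:: y 0 (lshift 1 0) * q; y 0 (lshift 1 1) * q; y 0 tcoord]`_j.

Definition stereo_inv (e : R) (v : rV3) : rV4 :=
  let n := v 0 0 * v 0 0 + v 0 1 * v 0 1 in
  let q := (1 + n)^-1 in
  row_mx (\row_(j < 3) [:: 2 * v 0 0 * q; 2 * v 0 1 * q; e * (n - 1) * q]`_j)
         (const_mx (v 0 2)).

Lemma stereoE (e : R) (y : rV4) : let q := (1 - e * y 0 (lshift 1 2))^-1 in
  [/\ stereo e y 0 0 = y 0 (lshift 1 0) * q,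
      stereo e y 0 1 = y 0 (lshift 1 1) * q & stereo e y 0 2 = y 0 tcoord].
Proof. by rewrite /stereo !mxE. Qed.

Lemma stereo_invE (e : R) (v : rV3) : let n := v 0 0 * v 0 0 + v 0 1 * v 0 1 in
  [/\ stereo_inv e v 0 (lshift 1 0) = 2 * v 0 0 * (1 + n)^-1,
      stereo_inv e v 0 (lshift 1 1) = 2 * v 0 1 * (1 + n)^-1,
      stereo_inv e v 0 (lshift 1 2) = e * (n - 1) * (1 + n)^-1 &
      stereo_inv e v 0 tcoord = v 0 2].
Proof. by rewrite /stereo_inv !row_mxEl row_mxEr !mxE. Qed.

Lemma norm_gt0 (v : rV3) : 0 < 1 + (v 0 0 * v 0 0 + v 0 1 * v 0 1).
Proof. by rewrite ltr_pwDl// addr_ge0// -expr2 sqr_ge0. Qed.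

Lemma smooth_stereo_inv (e : R) k : Ck k setT (stereo_inv e).
Proof.
have oT := @openT rV3.
have cc j := @Ck_coord R 3 k setT j.
pose n (v : rV3) := v 0 0 * v 0 0 + v 0 1 * v 0 1.
have cn : Ck k setT n by apply: CkD => //; apply: CkM.
have cq : Ck k setT (fun v => (1 + n v)^-1).
  apply: CkV => // [v _|]; first by rewrite gt_eqF// norm_gt0.
  by apply: CkD => //; exact: Ck_cst.
apply: Ck_row => // j; elim/ord4P: j => [|]; last first.
  apply: eq_Ck (cc 2) => // v _.
  by have [_ _ _ ->] := stereo_invE e v.
elim/ord3P.
- apply: (@eq_Ck _ _ _ _ _ (fun v : rV3 => 2 * v 0 0 * (1 + n v)^-1)) => //.
    by move=> v _; have [-> _ _ _] := stereo_invE e v.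
  by do 2?apply: CkM => //; exact: Ck_cst.
- apply: (@eq_Ck _ _ _ _ _ (fun v : rV3 => 2 * v 0 1 * (1 + n v)^-1)) => //.
    by move=> v _; have [_ -> _ _] := stereo_invE e v.
  by do 2?apply: CkM => //; exact: Ck_cst.
- apply: (@eq_Ck _ _ _ _ _ (fun v : rV3 => e * (n v - 1) * (1 + n v)^-1)) => //.
    by move=> v _; have [_ _ -> _] := stereo_invE e v.
  apply: CkM => //; apply: CkM => //; first exact: Ck_cst.
  by apply: CkD => //; exact: Ck_cst.
Qed.

Lemma open_stereo (e : R) : open [set y : rV4 | 1 - e * y 0 (lshift 1 2) != 0].
Proof.
apply: (@open_comp _ _ (fun y : rV4 => 1 - e * y 0 (lshift 1 2)) [set z | z != 0]).
  move=> y _; have c := @coord_continuous R 1 (3 + 1) 0 (lshift 1 2) y.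
  exact: (cvgB (cvg_cst _) (cvgM (cvg_cst e) c)).
exact: open_neq.
Qed.

Lemma smooth_stereo (e : R) k :
  Ck k [set y : rV4 | 1 - e * y 0 (lshift 1 2) != 0] (stereo e).
Proof.
set U := [set y | _]; have oU : open U by exact: open_stereo.
have cc j := @Ck_coord R (3 + 1) k U j.
have cq : Ck k U (fun y => (1 - e * y 0 (lshift 1 2))^-1).
  apply: CkV => //.
  apply: (@eq_Ck _ _ _ _ _ (fun y : rV4 => 1 + - e * y 0 (lshift 1 2))) => //.
    by move=> y _; rewrite mulNr.
  apply: CkD => //; first exact: Ck_cst.
  by apply: CkM => //; exact: Ck_cst.
apply: Ck_row => //; elim/ord3P.
- apply: eq_Ck (CkM oU (cc (lshift 1 0)) cq) => // y _.
  by have [-> _ _] := stereoE e y.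
- apply: eq_Ck (CkM oU (cc (lshift 1 1)) cq) => // y _.
  by have [_ -> _] := stereoE e y.
- apply: eq_Ck (cc tcoord) => // y _.
  by have [_ _ ->] := stereoE e y.
Qed.

(** Each point lies in the chart that projects from one of the two poles. *)
Lemma submanifold_S2xI : submanifold 3 (@S2xI R).
Proof.
move=> p /S2xIP[Sp tp].
have [e [e2 pe]] : exists e : R, e ^+ 2 = 1 /\ 1 - e * p 0 (lshift 1 2) != 0.
  have [p1|p1] := eqVneq (p 0 (lshift 1 2)) 1.
    exists (-1); split; first by rewrite sqrrN expr1n.
    by rewrite p1 mulN1r opprK gt_eqF// addr_gt0.
  by exists 1; split; rewrite ?expr1n// mul1r subr_eq0 eq_sym.
pose U := [set y : rV4 | 1 - e * y 0 (lshift 1 2) != 0].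
pose W := [set v : rV3 | -1 < v 0 2 < 1].
exists U, W, (stereo_inv e), (stereo e); split.
- by split; [exact: open_stereo|exact: pe].
- rewrite (_ : W = [set v : rV3 | -1 < v 0 2] `&` [set v : rV3 | v 0 2 < 1]).
    apply: openI.
      apply: (@open_comp _ _ (fun v : rV3 => v 0 2) [set z | -1 < z]).
        by move=> v _; exact: coord_continuous.
      exact: open_gt.
    apply: (@open_comp _ _ (fun v : rV3 => v 0 2) [set z | z < 1]).
      by move=> v _; exact: coord_continuous.
    exact: open_lt.
  by apply/seteqP; split=> v /= => [/andP|] [h1 h2]; [|apply/andP].
- apply/seteqP; split=> [_ [v Wv <-]|y [/S2xIP[Sy ty] Uy]].
    have [f0 f1 f2 f3] := stereo_invE e v; have n0 := norm_gt0 v.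
    have nn : 1 + (v 0 0 * v 0 0 + v 0 1 * v 0 1) != 0 by rewrite gt_eqF.
    split; last first.
      rewrite /U/= f2 mulrA mulrA -expr2 e2 mul1r.
      rewrite (_ : 1 - _ = 2 / (1 + (v 0 0 * v 0 0 + v 0 1 * v 0 1))).
        by rewrite mulf_neq0 ?invr_eq0// pnatr_eq0.
      by field.
    apply/S2xIP; rewrite sum3 f0 f1 f2 f3; split; last exact: Wv.
    rewrite !exprMn e2.
    by field.
  exists (stereo e y).
    by rewrite /W/=; have [_ _ ->] := stereoE e y.
  have [g0 g1 g2] := stereoE e y.
  have [f0 f1 f2 f3] := stereo_invE e (stereo e y).
  move: Sy; rewrite sum3 => Sy.
  pose d := 1 - e * y 0 (lshift 1 2).
  have d0 : d != 0 by exact: Uy.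
  have dd : y 0 (lshift 1 0) ^+ 2 + y 0 (lshift 1 1) ^+ 2 = 2 * d - d ^+ 2.
    have -> : d ^+ 2 = 1 - 2 * (e * y 0 (lshift 1 2)) + e ^+ 2 * y 0 (lshift 1 2) ^+ 2.
      by rewrite /d; ring.
    have Sz : y 0 (lshift 1 2) ^+ 2 =
        1 - y 0 (lshift 1 0) ^+ 2 - y 0 (lshift 1 1) ^+ 2 by rewrite -Sy; ring.
    by rewrite e2 Sz /d; ring.
  (* On the sphere x^2 + y^2 = (1 - e z)(1 + e z) = d (2 - d). *)
  have q : 1 + (stereo e y 0 0 * stereo e y 0 0 + stereo e y 0 1 * stereo e y 0 1)
      = 2 / d.
    rewrite g0 g1 -/d (_ : _ + _ = 1 +
      (y 0 (lshift 1 0) ^+ 2 + y 0 (lshift 1 1) ^+ 2) / d ^+ 2); last by field.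
    by rewrite dd; field.
  have n1 : stereo e y 0 0 * stereo e y 0 0 + stereo e y 0 1 * stereo e y 0 1 - 1
      = 2 / d - 2 by rewrite -q; ring.
  apply/rowP; elim/ord4P; last by rewrite f3 g2.
  elim/ord3P.
  - by rewrite f0 q g0 -/d; field.
  - by rewrite f1 q g1 -/d; field.
  - rewrite f2 q n1 (_ : y 0 (lshift 1 2) = e * (1 - d)); first by field.
    by rewrite /d opprB addrC subrK mulrA -expr2 e2 mul1r.
- split=> [v Wv|y [Ny Uy]].
    exists setT, (stereo_inv e); split=> //; first exact: openT.
    by move=> k; exact: smooth_stereo_inv.
  exists U, (stereo e); split=> //; first exact: open_stereo.
  by move=> k; exact: smooth_stereo.
- move=> v Wv; have [f0 f1 f2 f3] := stereo_invE e v; have n0 := norm_gt0 v.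
  have nn : 1 + (v 0 0 * v 0 0 + v 0 1 * v 0 1) != 0 by rewrite gt_eqF.
  have [g0 g1 g2] := stereoE e (stereo_inv e v).
  have q : (1 - e * stereo_inv e v 0 (lshift 1 2))^-1 =
      (1 + (v 0 0 * v 0 0 + v 0 1 * v 0 1)) / 2.
    rewrite f2 mulrA mulrA -expr2 e2 mul1r -[RHS]invf_div; congr (_^-1).
    by field.
  apply/rowP; elim/ord3P.
  + by rewrite g0 q f0; field.
  + by rewrite g1 q f1; field.
  + by rewrite g2 f3.
Qed.

Theorem riemannian_conformal (psi : R^o -> R^o) :
  smooth_on [set t : R^o | -1 < t < 1] psi ->
  (forall t : R, -1 < t < 1 -> 0 < psi t) ->
  riemannian_manifold 3 (@S2xI R) (conformal_metric psi).
Proof.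
move=> spsi psi0; split.
- exact: submanifold_S2xI.
- move=> p /S2xIP[_ pt]; have [U0 [F [oU0 U0t CF Fpsi]]] := spsi _ pt.
  pose U := [set q : rV4 | U0 (q 0 tcoord : R^o)].
  have oU : open U.
    apply: (@open_comp _ _ (fun q : rV4 => q 0 tcoord : R^o) U0) => // q _.
    exact: coord_continuous.
  exists U, (fun q : rV4 => (F (q 0 tcoord) : R) *: (1%:M : 'M[R]_(3 + 1))).
  split => //.
    move=> k; apply: CkZ => //.
    apply: (@Ck_comp _ _ _ _ U0 (fun q : rV4 => q 0 tcoord) F) => //.
    exact: Ck_coord.
  move=> q /S2xIP[_ qt] Uq; rewrite Fpsi// conformal_metricE.
  by rewrite scalemx1.
- by move=> p _; rewrite conformal_metricE tr_scalar_mx.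
- move=> p v /S2xIP[_ pt] _ v0; rewrite conformal_metricE bilin_scalar.
  rewrite mulr_gt0 ?psi0// lt_def sumr_ge0 ?andbT => [|i _]; last exact: sqr_ge0.
  apply: contra v0; rewrite psumr_eq0 => [/allP vi|i _]; last exact: sqr_ge0.
  apply/eqP/rowP => i; rewrite mxE; apply/eqP.
  by rewrite -sqrf_eq0; apply: (vi i); rewrite mem_index_enum.
Qed.

Theorem harmonic_slice (psi : R -> R) (t : R) : -1 < t < 1 ->
  (forall s, -1 < s < 1 -> {for s, continuous psi}) ->
  is_derive t 1 psi 0 -> Defs.harmonic (@S2xI R) (conformal_metric psi) (slice t).
Proof.
move=> t1 cpsi dpsi; split.
  by split; [exact: smooth_slice|move=> x; exact: slice_S2xI].
by move=> e w e0 wvar; exact: (slice_stationary e0 wvar cpsi dpsi).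
Qed.

Lemma energy_slice (psi : R -> R) (t : R) :
  energy (conformal_metric psi) (slice t) = 4 * pi * psi t.
Proof.
rewrite /energy (@eq_S2_integral _ _ (fun=> 2 * psi t)).
  by rewrite S2_integral_cst; field.
move=> x Sx; rewrite /grad_sq conformal_metricE (sliceE t x).2.
rewrite -(sum_tproj_sqr Sx) mulrC mulr_sumr; apply: eq_bigr => i _.
rewrite bilin_scalar (@derive_S2_ext_slice _ t _ _ i Sx)//.
rewrite -/(slice_diff x i) sum4 (slice_diffE x i).2 expr0n addr0.
by congr (_ * _); apply: eq_bigr => j _; rewrite (slice_diffE x i).1.
Qed.

End product_manifold.

(** * A smooth function with critical values accumulating at 1 *)

Section flat_functions.
Context {R : realType}.
Implicit Types (P Q S : {poly R}) (t u h : R).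

(** A class of functions that are flat at the origin and stable under
    derivation. *)
Definition flat P Q t : R := if t == 0 then 0 else
  expR (- (t ^+ 2)^-1) * (P.[t^-1] * sin t^-1 + Q.[t^-1] * cos t^-1).

(** The coefficients of the derivative, from [u' = - u^2] for [u = 1/t]. *)
Definition flat_sin P Q : {poly R} := 2 *: 'X^3 * P - 'X^2 * P^`() + 'X^2 * Q.
Definition flat_cos P Q : {poly R} := 2 *: 'X^3 * Q - 'X^2 * Q^`() - 'X^2 * P.

(** With [u = 1/h] and [n] the size of [S], the polynomial is at most a multiple
    of [`|u|^n], while [expR (u^2)] is at least [u^(2n+2) / (n+1)!]. *)
Lemma exp_poly_bound S : exists2 M, 0 <= M & forall h, h != 0 -> `|h| <= 1 ->
  expR (- (h ^+ 2)^-1) * `|S.[h^-1]| <= M * h ^+ 2.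
Proof.
pose n := size S; pose B := \sum_(i < size S) `|S`_i|.
have B0 : 0 <= B by apply: sumr_ge0 => i _.
exists ((n.+1)`!%:R * B) => [|h h0 h1]; first by rewrite mulr_ge0.
have nh : 0 < `|h| by rewrite normr_gt0.
have u1 : 1 <= `|h^-1| by rewrite normfV invf_ge1.
have Su : `|S.[h^-1]| <= B * `|h^-1| ^+ n.
  rewrite horner_coef mulr_suml (le_trans (ler_norm_sum _ _ _))//.
  apply: ler_sum => i _; rewrite normrM normrX ler_wpM2l//.
  by rewrite ler_weXn2l// ltnW// ltn_ord.
have h20 : 0 < h ^+ 2 by rewrite exprn_even_gt0.
have eu : expR (- (h ^+ 2)^-1) <= (n.+1)`!%:R * (h ^+ 2) ^+ n.+1.
  have f0 : 0 < (n.+1)`!%:R :> R by rewrite ltr0n fact_gt0.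
  have q0 : 0 < (n.+1)`!%:R * (h ^+ 2) ^+ n.+1 by rewrite mulr_gt0// exprn_gt0.
  rewrite expRN -[leRHS]invrK lef_pV2 ?posrE ?expR_gt0 ?invr_gt0//.
  apply: le_trans (expR_ge1Dxn n (ltW _)); last by rewrite invr_gt0.
  by rewrite invfM exprVn mulrC lerDr.
apply: (@le_trans _ _ (((n.+1)`!%:R * (h ^+ 2) ^+ n.+1) * (B * `|h^-1| ^+ n))).
  by apply: ler_pM => //; exact: expR_ge0.
have -> : (n.+1)`!%:R * (h ^+ 2) ^+ n.+1 * (B * `|h^-1| ^+ n) =
    (n.+1)`!%:R * B * (`|h| ^+ n.+2).
  rewrite -(real_normK (num_real h)) normfV exprVn -exprM.
  have -> : (2 * n.+1 = n.+2 + n)%N by rewrite mul2n -addnn !addSn addnS.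
  rewrite exprD; field.
  by rewrite expf_neq0// gt_eqF.
rewrite ler_wpM2l ?mulr_ge0// -(real_normK (num_real h)).
by rewrite ler_wiXn2l.
Qed.

(** At the origin [flat P Q] is bounded by a multiple of [h^2], so its derivative
    is 0. *)
Lemma is_derive_flat P Q t :
  is_derive t 1 (flat P Q) (flat (flat_sin P Q) (flat_cos P Q) t).
Proof.
have [->|t0] := eqVneq t 0.
  rewrite [X in is_derive _ _ _ X]/flat eqxx.
  have [M1 M10 HP] := exp_poly_bound P; have [M2 M20 HQ] := exp_poly_bound Q.
  have bound h : h != 0 -> `|h| <= 1 -> `|flat P Q h| <= (M1 + M2) * h ^+ 2.
    move=> h0 h1; rewrite /flat (negPf h0) normrM ger0_norm ?expR_ge0// mulrDl.
    apply: le_trans (lerD (HP _ h0 h1) (HQ _ h0 h1)); rewrite -mulrDr.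
    rewrite ler_wpM2l ?expR_ge0// (le_trans (ler_normD _ _))// !normrM.
    by rewrite lerD// ler_piMr// ?sin_max ?cos_max.
  have lim0 : h^-1 *: ((flat P Q \o shift 0) (h *: 1) - flat P Q 0)
      @[h --> (0 : R)^'] --> (0 : R).
    apply/cvgr0Pnorm_le => e e0.
    have d0 : 0 < e / (M1 + M2 + 1) by rewrite divr_gt0// ltr_wpDl// addr_ge0.
    near=> h; have h0 : h != 0 by near: h; exact: nbhs_dnbhs_neq.
    have h1 : `|h| <= 1 by apply/ltW; near: h; exact: (@dnbhs0_lt _ R^o _ ltr01).
    have hd : `|h| < e / (M1 + M2 + 1) by near: h; exact: (@dnbhs0_lt _ R^o _ d0).
    rewrite /= [_ *: 1]mulr1 addr0 [flat P Q 0]/flat eqxx subr0.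
    rewrite normrM normfV ler_pdivrMl ?normr_gt0//.
    rewrite (le_trans (bound _ h0 h1))// -(real_normK (num_real h)) expr2.
    rewrite mulrA mulrC ler_wpM2l//.
    apply: (@le_trans _ _ ((M1 + M2 + 1) * `|h|)).
      by rewrite ler_wpM2r// lerDl.
    by rewrite mulrC -ler_pdivlMr ?ltW// ltr_wpDl// addr_ge0.
  apply: DeriveDef; first by apply/cvg_ex; exists 0; exact: lim0.
  by apply/cvg_lim => //; exact: lim0.
pose H u := expR (- (u * u)) * (P.[u] * sin u + Q.[u] * cos u).
pose dH u := expR (- (u * u)) * (- (2 * u)) * (P.[u] * sin u + Q.[u] * cos u)
  + expR (- (u * u)) * ((P^`().[u] * sin u + P.[u] * cos u) +
      (Q^`().[u] * cos u + Q.[u] * - sin u)).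
have DH u : is_derive u 1 H (dH u).
  have D1 : is_derive u 1 (fun u : R => - (u * u)) (- (2 * u)).
    apply: is_derive_eq; rewrite -[LHS]/(- (u * 1 + u * 1)).
    by ring.
  have DE : is_derive u 1 (fun u : R => expR (- (u * u)))
      (expR (- (u * u)) * - (2 * u)).
    exact: (@is_derive1_comp R expR (fun u => - (u * u)) u _ _ _ D1).
  have DS : is_derive u 1 (fun u => P.[u] * sin u)
      (P^`().[u] * sin u + P.[u] * cos u).
    exact: is_derive_mul.
  have DC : is_derive u 1 (fun u => Q.[u] * cos u)
      (Q^`().[u] * cos u + Q.[u] * - sin u).
    exact: is_derive_mul.
  have DSC : is_derive u 1 (fun u : R => P.[u] * sin u + Q.[u] * cos u)
    (P^`().[u] * sin u + P.[u] * cos u + (Q^`().[u] * cos u + Q.[u] * - sin u)).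
    exact: (is_deriveD DS DC).
  exact: (is_derive_mul DE DSC).
have DV : is_derive t 1 (fun t : R => t^-1) (- (t ^- 2)).
  have DV := @is_deriveV R id t 1 1 t0 (is_derive_id t 1).
  by apply: (is_derive_eq DV); rewrite -[LHS]/(- t ^- 2 * 1) mulr1.
have D := is_derive1_comp (DH t^-1) DV.
have nE : \forall s \near t, (H \o (fun t => t^-1)) s = flat P Q s.
  have : \forall s \near t, s != 0.
    by apply: open_nbhs_nbhs; split => //; exact: open_neq.
  apply: filterS => s s0; rewrite /flat (negPf s0) /= /H.
  by rewrite -expr2 exprVn.
apply: is_derive_eq (near_eq_is_derive nE D) _.
rewrite /flat (negPf t0) /dH /flat_sin /flat_cos.
rewrite !(hornerD, hornerN, hornerM, hornerZ, hornerXn, hornerX).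
rewrite (_ : (t ^+ 2)^-1 = t^-1 * t^-1); last by rewrite -exprVn expr2.
by ring.
Unshelve. all: by end_near. Qed.

Lemma Ck_flat k P Q : Ck k setT (flat P Q : R^o -> R^o).
Proof.
elim: k P Q => [|k IHk] P Q.
  move=> t _; apply: differentiable_continuous; apply/derivable1_diffP.
  by have [] := is_derive_flat P Q t.
have df t : differentiable (flat P Q : R^o -> R^o) t.
  by apply/derivable1_diffP; have [] := is_derive_flat P Q t.
split=> [t _|v]; first exact: df.
rewrite (_ : 'D_v _ = flat (v *: flat_sin P Q) (v *: flat_cos P Q)); first exact: IHk.
apply/funext => t; rewrite deriveE// -[X in 'd _ _ X]mulr1.
rewrite -[X in 'd _ _ X]/(v *: (1 : R^o)) linearZ -deriveE//.
have [_ ->] := is_derive_flat P Q t.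
rewrite /flat; case: ifP => _; first exact: mulr0.
by rewrite !hornerZ -[LHS]/(v * _); ring.
Qed.

Definition example_psi (t : R^o) : R^o := flat 1 0 t + 1.

Lemma example_psiE t : t != 0 ->
  example_psi t = expR (- (t ^+ 2)^-1) * sin t^-1 + 1.
Proof.
by move=> t0; rewrite /example_psi /flat (negPf t0) !hornerE.
Qed.

Lemma example_psi0 : example_psi 0 = 1.
Proof. by rewrite /example_psi /flat eqxx add0r. Qed.

Lemma example_psi_smooth (A : set R^o) : smooth_on A example_psi.
Proof.
move=> t _; exists setT, example_psi; split=> //; first exact: openT.
by move=> k; apply: CkD; [exact: openT|exact: Ck_flat|exact: Ck_cst].
Qed.

Lemma example_psi_gt0 t : 0 < example_psi t.
Proof.
have [->|t0] := eqVneq t 0; first by rewrite example_psi0.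
rewrite example_psiE// -ltrBlDr sub0r.
have e1 : expR (- (t ^+ 2)^-1) < 1.
  by rewrite expR_lt1 oppr_lt0 invr_gt0 exprn_even_gt0.
have s1 := sin_geN1 t^-1; have e0 := expR_gt0 (- (t ^+ 2)^-1).
have : - expR (- (t ^+ 2)^-1) <= expR (- (t ^+ 2)^-1) * sin t^-1.
  by rewrite -mulrN1 ler_wpM2l// ltW.
by apply: lt_le_trans; rewrite ltrN2.
Qed.

Lemma is_derive_example_psi0 : is_derive (0 : R) 1 example_psi 0.
Proof.
have D := is_deriveD (is_derive_flat 1 0 0) (is_derive_cst (1 : R) (0 : R) 1).
by apply: is_derive_eq D _; rewrite /flat eqxx addr0.
Qed.

End flat_functions.

(** * Critical points and the accumulation of energies *)

Section critical_points.
Context {R : realType}.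

Lemma smooth_on_differentiable (psi : R^o -> R^o) (t : R) :
  smooth_on [set t : R^o | -1 < t < 1] psi -> -1 < t < 1 ->
  differentiable psi t.
Proof.
move=> spsi t1; have [U [F [oU Ut CF Fpsi]]] := spsi t t1.
have [dF _] := CF 1%N.
apply: near_eq_differentiable (dF _ Ut).
have oI : open [set t : R^o | -1 < t < 1].
  rewrite (_ : [set _ | _] = `](-1), 1[%classic); first exact: interval_open.
  by apply/seteqP; split=> s /=; rewrite in_itv.
have nU := open_nbhs_nbhs (conj oU Ut); have nI := open_nbhs_nbhs (conj oI t1).
by apply: filterS2 nU nI => s Us s1; exact: Fpsi.
Qed.

Lemma sin_gt0_period (n : nat) (x : R) :
  0 < x - (pi *+ 2) *+ n < pi -> 0 < sin x.
Proof.
move=> /sin_gt0_pi; rewrite -(periodicn (@sinD2pi R) n (x - pi *+ 2 *+ n)).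
by rewrite subrK.
Qed.

(** Between two consecutive zeros of [sin (1/t)] bounding an interval where it
    is positive, Rolle's theorem gives a critical point of [psi], where the
    oscillating term is positive but smaller than [t]. *)
Lemma critical_values (psi : R -> R) (d : R) : 0 < d ->
  (forall t : R, -1 < t < 1 -> derivable psi t 1) ->
  (forall t : R, - 2^-1 < t < 2^-1 -> t != 0 ->
     psi t = expR (- (t ^+ 2)^-1) * sin t^-1 + 1) ->
  exists t : R, [/\ -1 < t < 1, is_derive t 1 psi 0 & 1 < psi t < 1 + d].
Proof.
move=> d0 dpsi psiE; pose p2 : R := pi *+ 2.
have pi2 := pi_ge2 R; have p24 : 4 <= p2 by rewrite /p2 mulr2n; lra.
pose n := (Num.trunc d^-1).+1; pose A : R := p2 *+ n; pose B : R := A + pi.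
have nd : d^-1 < n%:R by exact: truncnS_gt.
have n1 : 1 <= n%:R :> R by rewrite ler1n.
have AE : A = p2 * n%:R by rewrite /A mulr_natr.
have BE : B = A + pi by [].
have sA : sin A = 0.
  by rewrite -[A]add0r /A (periodicn (@sinD2pi R)) sin0.
have sB : sin B = 0.
  by rewrite /B /A addrC (periodicn (@sinD2pi R)) sinpi.
have sAB x : A < x < B -> 0 < sin x.
  move=> /andP[Ax xB]; apply: (@sin_gt0_period n); rewrite -/A.
  by rewrite subr_gt0 Ax ltrBlDl.
clearbody p2 A B.
have p20 : 0 <= p2 by lra.
have p21 : 1 <= p2 by lra.
have A4 : 4 <= A by apply: le_trans p24 _; rewrite AE ler_peMr.
have Ad : d^-1 < A by apply: lt_le_trans nd _; rewrite AE ler_peMl.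
have AB : A < B by rewrite BE ltrDl pi_gt0.
have A0 : 0 < A by lra.
have B0 : 0 < B by lra.
have ba : B^-1 < A^-1 by rewrite ltf_pV2 ?posrE.
have b0 : 0 < B^-1 by rewrite invr_gt0.
have a2 : A^-1 < 2^-1 by rewrite ltf_pV2 ?posrE//; lra.
have ad : A^-1 < d by rewrite -[d]invrK ltf_pV2 ?posrE ?invr_gt0.
have pe t : B^-1 <= t <= A^-1 -> psi t = expR (- (t ^+ 2)^-1) * sin t^-1 + 1.
  by move=> /andP[t1 t2]; apply: psiE; [apply/andP; split|rewrite gt_eqF]; lra.
have in1 t : B^-1 <= t <= A^-1 -> -1 < t < 1.
  by move=> /andP[t1 t2]; apply/andP; split; lra.
have [|||c] := @Rolle R psi B^-1 A^-1 ba.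
- by move=> t; rewrite in_itv/= => /andP[t1 t2]; apply/dpsi/in1; rewrite !ltW.
- apply: derivable_within_continuous => t; rewrite in_itv/= => tt.
  exact/dpsi/in1.
- rewrite !pe ?lexx ?(ltW ba)// !invrK sA sB; ring.
rewrite in_itv/= => /andP[c1 c2] Dc.
have c0 : 0 < c by lra.
have cI : B^-1 <= c <= A^-1 by rewrite !ltW.
have ci : A < c^-1 < B.
  rewrite -[A]invrK -[B]invrK !ltf_pV2 ?posrE ?invr_gt0//.
  by rewrite c1 c2.
have sc : 0 < sin c^-1.
  exact: sAB.
have e0 := expR_gt0 (- (c ^+ 2)^-1).
exists c; split; [exact: in1|exact: Dc|].
rewrite pe//; apply/andP; split; first by rewrite ltrDr mulr_gt0.
rewrite addrC ltrD2l; apply: le_lt_trans (_ : c < d); last by lra.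
apply: (@le_trans _ _ (expR (- (c ^+ 2)^-1))).
  by rewrite ler_piMr ?sin_le1// ltW.
have c20 : 0 < c ^+ 2 by rewrite exprn_gt0.
apply: (@le_trans _ _ (c ^+ 2)); last first.
  by rewrite expr2 ler_piMl ?ltW//; lra.
rewrite expRN -[leRHS]invrK lef_pV2 ?posrE ?expR_gt0 ?invr_gt0//.
by apply: le_trans (expR_ge1Dx _); rewrite lerDr.
Qed.

Lemma limit_point_energy (psi : R^o -> R^o) :
  smooth_on [set t : R^o | -1 < t < 1] psi ->
  (forall t : R, - 2^-1 < t < 2^-1 -> t != 0 ->
     psi t = expR (- (t ^+ 2)^-1) * sin t^-1 + 1) ->
  limit_point (energy_set (@S2xI R) (conformal_metric psi)) (4 * pi).
Proof.
move=> spsi psiE V /nbhs_ballP[r /= r0 rV].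
have dpsi (t : R) : -1 < t < 1 -> differentiable psi t.
  exact: smooth_on_differentiable.
have p0 : 0 < 4 * pi :> R by rewrite mulr_gt0 ?pi_gt0.
have d0 : 0 < r / (4 * pi) by rewrite divr_gt0.
have [|t [t1 Dt /andP[pt1 ptd]]] := critical_values d0 _ psiE.
  by move=> t /dpsi /derivable1_diffP.
exists (4 * pi * psi t); split.
- by rewrite gt_eqF// ltr_pMr.
- exists (slice t); last exact: energy_slice.
  apply: harmonic_slice => // s s1.
  by apply: differentiable_continuous; exact: dpsi.
- apply: rV; rewrite /ball/= distrC ger0_norm ?subr_ge0; last first.
    by rewrite ler_pMr// ltW.
  rewrite -[X in _ - X]mulr1 -mulrBr mulrC -ltr_pdivlMr//.
  by rewrite ltrBlDl.
Qed.

End critical_points.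

Theorem mainTheorem2 (R : realType) :
  (forall psi : R^o -> R^o,
     smooth_on [set t : R^o | -1 < t < 1] psi ->
     (forall t : R, -1 < t < 1 -> 0 < psi t) ->
     (forall t : R, - 2^-1 < t < 2^-1 -> t != 0 ->
        psi t = expR (- (t ^+ 2)^-1) * sin t^-1 + 1) ->
     psi 0 = 1 ->
     riemannian_manifold 3 (@S2xI R) (conformal_metric psi) /\
     limit_point (energy_set (@S2xI R) (conformal_metric psi)) (4 * pi)) /\
  (exists (m n : nat) (N : set 'rV[R]_n) (h : 'rV[R]_n -> 'M[R]_n),
     riemannian_manifold m N h /\ ~ discrete_set (energy_set N h)).
Proof.
split=> [psi spsi psi_gt0 psiE _|].
  by split; [exact: riemannian_conformal|exact: limit_point_energy].
have spsi := @example_psi_smooth R [set t : R^o | -1 < t < 1].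
exists 3%N, (3 + 1)%N, (@S2xI R), (conformal_metric (@example_psi R)); split.
  by apply: riemannian_conformal => // t _; exact: example_psi_gt0.
have E4 : energy_set (@S2xI R) (conformal_metric (@example_psi R)) (4 * pi).
  exists (slice 0); last by rewrite energy_slice example_psi0 mulr1.
  apply: harmonic_slice; [by rewrite ltrN10 ltr01| |exact: is_derive_example_psi0].
  move=> s s1; apply: differentiable_continuous.
  exact: smooth_on_differentiable.
move=> /(_ _ E4)[_ [V V4 VE]].
have [|y [y4 Ey Vy]] := @limit_point_energy R (@example_psi R) spsi _ V V4.
  by move=> t _; exact: example_psiE.
have : (V `&` energy_set (@S2xI R) (conformal_metric (@example_psi R))) y by [].
by rewrite VE => /= yE; rewrite yE eqxx in y4.
Qed.
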